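(* Let $\mathcal Q$ be in $D_{b,\mathrm{coh}}(\mathrm{qc}/\mathbf P(W))$. Then the complex $G_{S(W)}\circ\mathbf R\Gamma_*(\mathbf P(W),\mathcal Q)$ of graded left $E(V)$-modules is acyclic.
   Context: Let $k$ be a field, $V$ a finite-dimensional $k$-vector space, $W=V^*$. $S(W)$ and $E(V)=\bigoplus_i\wedge^iV$ are the symmetric and exterior algebras, positively graded with $W$, $V$ in degree $1$; $\mathbf P(W)=\mathrm{Proj}\,S(W)$. Modules are graded left modules with degree-$0$ homomorphisms, $M(r)_q=M_{r+q}$; for a complex $N$, $N^p_q$ is the degree-$q$ part of the $p$-th component. $\omega_E=\bigoplus_i\mathrm{Hom}_k(\wedge^iV,k)$ (with $\mathrm{Hom}_k(\wedge^iV,k)$ in degree $-i$) is the graded dual of $E(V)$, an $E(V)$-bimodule. $D_{b,\mathrm{coh}}(\mathrm{qc}/\mathbf P(W))$ is the full subcategory of the derived category of quasi-coherent sheaves on $\mathbf P(W)$ consisting of complexes whose cohomology sheaves are coherent and only finitely many nonzero. $\mathbf R\Gamma_*(\mathbf P(W),\mathcal Q)=\Gamma_*(\mathcal I)$ where $\mathcal Q\to\mathcal I$ is a bounded below resolution by injective quasi-coherent sheaves and $\Gamma_*(\mathcal F)=\bigoplus_{n\in\mathbf Z}\Gamma(\mathbf P(W),\mathcal F(n))$, a graded $S(W)$-module. With $\{v_\alpha\}$ a basis of $W$ and $\{\check v_\alpha\}$ the dual basis of $V$: for a complex $N$ of graded $S(W)$-modules, $G_{S(W)}(N)$ is the total complex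 of the double complex with terms $\omega_E(q)\otimes_k N^p_q$ in total degree $p+q$, with differentials $\mathrm{id}\otimes d_N$ and $l\otimes n\mapsto\sum_\alpha l\check v_\alpha\otimes v_\alpha n$. *)

(* Defs.v *)
From HB Require Import structures.
From mathcomp Require Import all_boot all_order all_algebra.
From mathcomp Require Import mpoly boolp zify.

Set Implicit Arguments.
Unset Strict Implicit.
Unset Printing Implicit Defensive.
Import Order.TTheory GRing.Theory Num.Theory.
Local Open Scope ring_scope.

(* The exterior algebra of k^n, in its standard basis e_A indexed by the
   subsets A of {0, .., n-1}: e_A is the increasing product of the e_a, a in A,
   and e_A e_B = (-1)^#{(a, b) in A x B | b < a} e_(A u B) if A and B are
   disjoint, 0 otherwise. *)
Section Exterior.
Variables (k : fieldType) (n : nat).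
Implicit Types A B C D : {set 'I_n}.

Definition ext : Type := {ffun {set 'I_n} -> k^o}.

HB.instance Definition _ := Vector.on ext.

Definition ninv A B : nat := (\sum_(a in A) \sum_(b in B) (b < a)%N)%N.

Definition ext_mul (x y : ext) : ext :=
  [ffun C : {set 'I_n} => \sum_(A : {set 'I_n} | A \subset C)
               (-1) ^+ ninv A (C :\: A) * (x A : k) * y (C :\: A)].

Definition ebasis A : ext := [ffun B => (B == A)%:R].

Lemma ninvUl A B C : [disjoint A & B] ->
  ninv (A :|: B) C = (ninv A C + ninv B C)%N.
Proof.
by move=> h; rewrite /ninv -bigU //; apply: eq_bigl => i; rewrite !inE.
Qed.

Lemma ninvUr A B C : [disjoint B & C] ->
  ninv A (B :|: C) = (ninv A B + ninv A C)%N.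
Proof.
move=> h; rewrite /ninv -big_split; apply: eq_bigr => a _; rewrite -bigU //.
by apply: eq_bigl => i; rewrite !inE.
Qed.

Lemma ninv0l B : ninv set0 B = 0%N.
Proof. by rewrite /ninv big_set0. Qed.

Lemma ninv0r A : ninv A set0 = 0%N.
Proof. by rewrite /ninv big1 // => a _; rewrite big_set0. Qed.

Lemma ext_mulA : associative ext_mul.
Proof.
move=> x y z; apply/ffunP => D; rewrite !ffunE.
under eq_bigr => A _ do rewrite ffunE mulr_sumr.
under [RHS]eq_bigr => C _ do rewrite ffunE mulr_sumr mulr_suml.
rewrite [RHS](exchange_big_dep xpredT) //= [LHS]big_mkcond /=.
apply: eq_bigr => A _; rewrite -[LHS]/(if _ then _ else _).
transitivity (\sum_(B : {set 'I_n} | (A \subset D) && (B \subset D :\: A))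
    (-1) ^+ ninv A (D :\: A) * (x A : k) * ((-1) ^+ ninv B (D :\: A :\: B) *
      (y B : k) * z (D :\: A :\: B))).
  by case: ifP => //= _; rewrite big_pred0.
rewrite [RHS](reindex_onto (fun B => A :|: B) (fun C => C :\: A)); last first.
  by move=> C /andP[_ AC]; rewrite setDE setUIr setUCr setIT; apply/setUidPr.
apply: eq_big => [B|B /andP[AD BDA]].
  rewrite subsetUl andbT subUset subsetD setDUl setDv set0U -andbA.
  congr (_ && (_ && _)).
  apply/idP/eqP => [h|<-]; first by apply/setDidPl.
  by rewrite disjoint_sym disjoints_subset setDE setCI setCK subsetUr.
have dAB : [disjoint A & B].
  by move: BDA; rewrite subsetD disjoint_sym => /andP[].
have BD : B \subset D by move: BDA; rewrite subsetD => /andP[].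
have -> : (A :|: B) :\: A = B.
  by rewrite setDUl setDv set0U; apply/setDidPl; rewrite disjoint_sym.
rewrite -setDDl.
set E := D :\: A :\: B.
have dBE : [disjoint B & E].
  by rewrite disjoints_subset /E !setDE !setCI !setCK subsetUr.
have -> : D :\: A = B :|: E.
  by rewrite /E [_ :\: B]setDE setUIr setUCr setIT; apply/esym/setUidPr.
rewrite ninvUl // ninvUr // !exprD.
set a := (x A : k); set b := (y B : k); set c := (z E : k).
set s1 := _ ^+ ninv A B; set s2 := _ ^+ ninv A E; set s3 := _ ^+ ninv B E.
by rewrite !mulrA [s2 * s3 * s1]mulrC !mulrA -[_ * a * s3]mulrA [a * s3]mulrC !mulrA.
Qed.

Lemma ext_mul1l : left_id (ebasis set0) ext_mul.
Proof.
move=> x; apply/ffunP => C; rewrite ffunE (bigD1 set0) ?sub0set //=.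
rewrite ffunE eqxx ninv0l expr0 !mul1r setD0 big1 ?addr0 // => A /andP[_ nA].
by rewrite ffunE (negPf nA) mulr0 mul0r.
Qed.

Lemma ext_mul1r : right_id (ebasis set0) ext_mul.
Proof.
move=> x; apply/ffunP => C; rewrite ffunE (bigD1 C) //=.
rewrite ffunE setDv eqxx ninv0r expr0 mul1r mulr1 big1 ?addr0 // => A /andP[sA nA].
rewrite ffunE setD_eq0; case: (boolP (C \subset A)) => [sC|_]; last by rewrite mulr0.
by move: nA; rewrite eqEsubset sA sC.
Qed.

Lemma ext_mulDl : left_distributive ext_mul +%R.
Proof.
move=> x y z; apply/ffunP => C; rewrite !ffunE -big_split.
by apply: eq_bigr => A _; rewrite ffunE mulrDr mulrDl.
Qed.

Lemma ext_mulDr : right_distributive ext_mul +%R.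
Proof.
move=> x y z; apply/ffunP => C; rewrite !ffunE -big_split.
by apply: eq_bigr => A _; rewrite ffunE mulrDr.
Qed.

Lemma ext_1neq0 : ebasis set0 != 0.
Proof. by apply/eqP => /ffunP /(_ set0) /eqP; rewrite !ffunE eqxx oner_eq0. Qed.

HB.instance Definition _ := GRing.Zmodule_isNzRing.Build ext
  ext_mulA ext_mul1l ext_mul1r ext_mulDl ext_mulDr ext_1neq0.

Lemma ext_mulE (x y : ext) C : (x * y) C =
  \sum_(A : {set 'I_n} | A \subset C)
    (-1) ^+ ninv A (C :\: A) * (x A : k) * y (C :\: A).
Proof. exact: ffunE. Qed.

Lemma ext_scalerAl (c : k) (x y : ext) : c *: (x * y) = (c *: x) * y.
Proof.
apply/ffunP => C; rewrite ffunE !ext_mulE scaler_sumr; apply: eq_bigr => A _.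
by rewrite ffunE /GRing.scale /= mulrA mulrCA !mulrA.
Qed.

HB.instance Definition _ := GRing.Lmodule_isLalgebra.Build k ext ext_scalerAl.

Lemma ext_scalerAr (c : k) (x y : ext) : c *: (x * y) = x * (c *: y).
Proof.
apply/ffunP => C; rewrite ffunE !ext_mulE scaler_sumr; apply: eq_bigr => A _.
by rewrite ffunE /GRing.scale /= mulrCA.
Qed.

HB.instance Definition _ := GRing.Lalgebra_isAlgebra.Build k ext ext_scalerAr.

Lemma ext_basisE (x : ext) : x = \sum_A x A *: ebasis A.
Proof.
apply/ffunP => B; rewrite sum_ffunE (bigD1 B) //= big1 ?addr0 => [|A nA].
  by rewrite !ffunE eqxx /GRing.scale /= mulr1.
by rewrite !ffunE eq_sym (negPf nA) scaler0.
Qed.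

Lemma ebasisM A B : ebasis A * ebasis B =
  if [disjoint A & B] then (-1) ^+ ninv A B *: ebasis (A :|: B) else 0.
Proof.
apply/ffunP => C; rewrite ext_mulE.
case: ifPn => dAB; last first.
  rewrite !ffunE big1 // => D sD; rewrite !ffunE.
  case: eqP => [->|_]; last by rewrite mulr0 mul0r.
  case: eqP => [e|_]; last by rewrite mulr0.
  by move: dAB; rewrite disjoints_subset -e setDE setCI setCK subsetUr.
rewrite !ffunE; case: eqP => [->|ne].
  rewrite (bigD1 A) ?subsetUl //= big1 ?addr0 => [|D /andP[_ nD]].
    have -> : (A :|: B) :\: A = B.
      by rewrite setDUl setDv set0U; apply/setDidPl; rewrite disjoint_sym.
    by rewrite !ffunE !eqxx /GRing.scale /= !mulr1.
  by rewrite !ffunE (negPf nD) mulr0 mul0r.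
rewrite scaler0 big1 // => D sD; rewrite !ffunE.
case: eqP => [e|_]; last by rewrite mulr0 mul0r.
case: eqP => [e'|_]; last by rewrite mulr0.
by case: ne; rewrite -e -e' setDE setUIr setUCr setIT; apply/esym/setUidPr.
Qed.

(* The degree d component, the d-th exterior power of k^n. *)
Definition ext_homog (d : int) (x : ext) : Prop :=
  forall A, x A != 0 -> #|A|%:Z = d.

End Exterior.

(* E(V) and S(V) in the coordinates of the basis vbasis fullv of V, with the
   canonical maps from V. *)
Section Algebras.
Variables (k : fieldType) (V : vectType k).

Definition ExtAlg := ext k (\dim {:V}).

Definition ext_in (v : V) : ExtAlg :=
  \sum_i coord (vbasis {:V}) i v *: ebasis k [set i].

Definition SymAlg := {mpoly k[\dim {:V}]}.

Definition sym_in (v : V) : SymAlg :=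
  \sum_i coord (vbasis {:V}) i v *: 'X_i.

Lemma ext_in_homog v : ext_homog 1 (ext_in v).
Proof.
move=> A; apply: contraNeq => hA; rewrite sum_ffunE big1 // => i _.
rewrite !ffunE; case: eqP => [e|_]; last by rewrite scaler0.
by case/eqP: hA; rewrite e cards1.
Qed.

Lemma ext_in_sq v : ext_in v * ext_in v = 0.
Proof.
set f := fun i => coord (vbasis {:V}) i v *: ebasis k [set i].
have ff i : f i * f i = 0.
  by rewrite /f -scalerAl -scalerAr ebasisM disjoints1 inE eqxx !scaler0.
have fC i j : f i * f j = - (f j * f i).
  have [->|ne] := eqVneq i j; first by rewrite ff oppr0.
  rewrite /f -!scalerAl -!scalerAr !scalerA [_ * coord _ j v]mulrC -scalerN.
  congr (_ *: _); rewrite !ebasisM !disjoints1 !inE [j == i]eq_sym (negPf ne) /=.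
  rewrite setUC -scaleNr; congr (_ *: _); rewrite /ninv !big_set1.
  by case: ltngtP ne => [_ _|_ _|/val_inj->]; rewrite ?expr1 ?expr0 ?opprK ?eqxx.
rewrite /ext_in -/f; elim: (index_enum _) => [|i r IH].
  by rewrite big_nil mul0r.
rewrite big_cons mulrDl !mulrDr ff IH addr0 add0r mulr_sumr mulr_suml -big_split.
by rewrite big1 // => j _ /=; rewrite fC addNr.
Qed.

Lemma ext_inD : {morph ext_in : u v / u + v}.
Proof.
move=> u v; rewrite /ext_in -big_split; apply: eq_bigr => i _ /=.
by rewrite linearD scalerDl.
Qed.

Lemma ext_in_anti u v : ext_in u * ext_in v = - (ext_in v * ext_in u).
Proof.
have := ext_in_sq (u + v); rewrite ext_inD mulrDl !mulrDr !ext_in_sq add0r addr0.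
by move/eqP; rewrite addr_eq0 => /eqP.
Qed.

Lemma sym_in_homog v : sym_in v \is 1.-homog.
Proof.
apply: rpred_sum => i _; apply: rpredZ; by rewrite dhomogX /= mdeg1.
Qed.
End Algebras.


Section SymGrading.
Variables (k : fieldType) (n : nat).

(* The degree d component of k[x_0, .., x_(n-1)], which is 0 if d < 0. *)
Definition sym_homog (d : int) (f : {mpoly k[n]}) : Prop :=
  forall m, m \in msupp f -> (mdeg m)%:Z = d.

Lemma sym_homogP (d : nat) f : sym_homog d f <-> f \is d.-homog.
Proof.
split=> [h|/dhomogP h m /h <- //].
by apply/dhomogP => m /h /= [].
Qed.

Lemma sym_homog0 d : sym_homog d 0.
Proof. by move=> m; rewrite msupp0. Qed.

Lemma sym_homogC d c : sym_homog (d - d) c%:MP.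
Proof.
move=> m; rewrite msuppC subrr; case: ifP => // _; rewrite inE => /eqP ->.
by rewrite mdeg0.
Qed.

Lemma sym_homog1 d : sym_homog (d - d) 1.
Proof. by rewrite -mpolyC1; exact: sym_homogC. Qed.

Lemma sym_homog_ge0 d f : sym_homog d f -> f != 0 -> exists e : nat, d = e.
Proof. by move=> h f0; exists (mdeg (mlead f)); rewrite (h _ (mlead_supp f0)). Qed.

Lemma sym_homogD d f g : sym_homog d f -> sym_homog d g -> sym_homog d (f + g).
Proof.
move=> hf hg m /msuppD_le; rewrite mem_cat => /orP[/hf|/hg] //.
Qed.

Lemma sym_homogN d f : sym_homog d f -> sym_homog d (- f).
Proof. by move=> hf m; rewrite (perm_mem (msuppN f)) => /hf. Qed.

Lemma sym_homogM d e f g :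
  sym_homog d f -> sym_homog e g -> sym_homog (d + e) (f * g).
Proof.
have [->|f0 hf] := eqVneq f 0; first by rewrite mul0r => *; exact: sym_homog0.
have [->|g0 hg] := eqVneq g 0; first by rewrite mulr0 => *; exact: sym_homog0.
have [a da] := sym_homog_ge0 hf f0; have [b db] := sym_homog_ge0 hg g0.
move: hf hg; rewrite da db => /sym_homogP hf /sym_homogP hg.
by rewrite -PoszD; apply/sym_homogP/dhomogM.
Qed.
End SymGrading.

(* Graded left modules over a graded ring R with components R_d = hd d, the
   component R_(r-q) acting from degree q to degree r. *)
Section GradedModules.
Variables (R : pzRingType) (hd : int -> R -> Prop).

Record gmod := GMod {
  gpart :> int -> zmodType;
  gact : forall q r a, hd (r - q) a -> gpart q -> gpart r;
  gactDr : forall q r a (ha : hd (r - q) a) x y,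
    gact ha (x + y) = gact ha x + gact ha y;
  gactDl : forall q r a b (ha : hd (r - q) a) (hb : hd (r - q) b)
    (hab : hd (r - q) (a + b)) x, gact hab x = gact ha x + gact hb x;
  gact1 : forall q (h1 : hd (q - q) 1) x, gact h1 x = x;
  gactM : forall q r s a b (hb : hd (r - q) b) (ha : hd (s - r) a)
    (hab : hd (s - q) (a * b)) x, gact hab x = gact ha (gact hb x) }.

(* The differentials take a proof of p' = p + 1 instead of being indexed by p
   only, so that no transport along equalities of degrees is ever needed. *)
Record gcomplex := GComplex {
  gterm :> int -> gmod;
  gdiff : forall p p' q, p' = p + 1 -> gterm p q -> gterm p' q;
  gdiffD : forall p p' q (h : p' = p + 1) (x y : gterm p q),
    gdiff h (x + y) = gdiff h x + gdiff h y;
  gdiffZ : forall p p' (h : p' = p + 1) q r a (ha : hd (r - q) a)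
    (x : gterm p q), gdiff h (gact ha x) = gact ha (gdiff h x);
  gdiffK : forall p p' p'' q (h : p' = p + 1) (h' : p'' = p' + 1)
    (x : gterm p q), gdiff h' (gdiff h x) = 0 }.

Definition acyclic (C : gcomplex) : Prop :=
  forall p0 p1 p2 q (h01 : p1 = p0 + 1) (h12 : p2 = p1 + 1) (x : C p1 q),
    gdiff h12 x = 0 -> exists y : C p0 q, gdiff h01 y = x.

Variable (M : gmod).
Lemma gact_irr q r a b (ha : hd (r - q) a) (hb : hd (r - q) b) (x : M q) :
  a = b -> gact ha x = gact hb x.
Proof. by move=> e; move: hb; rewrite -e => hb; congr gact; apply: Prop_irrelevance. Qed.

Lemma gact0r q r a (ha : hd (r - q) a) : gact ha (0 : M q) = 0.
Proof. by apply: (addrI (gact ha 0)); rewrite -gactDr !addr0. Qed.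

Lemma gactNr q r a (ha : hd (r - q) a) (x : M q) : gact ha (- x) = - gact ha x.
Proof. by apply/eqP; rewrite -addr_eq0 -gactDr addNr gact0r. Qed.

Lemma gact_sumr q r a (ha : hd (r - q) a) I (s : seq I) (P : pred I) (F : I -> M q) :
  gact ha (\sum_(i <- s | P i) F i) = \sum_(i <- s | P i) gact ha (F i).
Proof.
elim/big_rec2: _ => [|i y x _ <-]; [exact: gact0r|exact: gactDr].
Qed.

Variable (C : gcomplex).
Lemma gdiff0 p p' q (h : p' = p + 1) : gdiff h (0 : C p q) = 0.
Proof. by apply: (addrI (gdiff h 0)); rewrite -gdiffD !addr0. Qed.
Lemma gdiffN p p' q (h : p' = p + 1) (x : C p q) : gdiff h (- x) = - gdiff h x.
Proof. by apply/eqP; rewrite -addr_eq0 -gdiffD addNr gdiff0. Qed.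
Lemma gdiff_sum p p' q (h : p' = p + 1) I (s : seq I) (P : pred I) (F : I -> C p q) :
  gdiff h (\sum_(i <- s | P i) F i) = \sum_(i <- s | P i) gdiff h (F i).
Proof.
elim/big_rec2: _ => [|i y x _ <-]; [exact: gdiff0|exact: gdiffD].
Qed.
End GradedModules.

(* The E(V)-bimodule omega_E = Hom_k(E(V), k): the action is
   (x l)(y) = l(y x) and (l x)(y) = l(x y); its degree -i part is dual to the
   i-th exterior power. *)
Section Omega.
Variables (k : fieldType) (n : nat).
Implicit Types A B : {set 'I_n}.

Definition omega := 'Hom(ext k n, k^o).

Definition omega_l (x : ext k n) (l : omega) : omega := linfun (fun y : ext k n => l (y * x)).
Definition omega_r (l : omega) (x : ext k n) : omega := linfun (fun y : ext k n => l (x * y)).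

Definition estar A : omega := linfun (fun x : ext k n => x A).

Lemma linfunP (f : ext k n -> k^o) : linear f -> linfun f =1 f.
Proof.
move=> lf x; pose F := GRing.isLinear.Build _ _ _ _ f lf.
pose g : {linear ext k n -> k^o} := HB.pack f F.
exact: (lfunE g).
Qed.

Lemma omega_lE x l y : omega_l x l y = l (y * x).
Proof. by rewrite linfunP // => c a b; rewrite mulrDl -scalerAl linearP. Qed.
Lemma omega_rE x l y : omega_r l x y = l (x * y).
Proof. by rewrite linfunP // => c a b; rewrite mulrDr -scalerAr linearP. Qed.
Lemma estarE A x : estar A x = x A.
Proof. by rewrite linfunP // => c a b; rewrite !ffunE. Qed.
End Omega.

Lemma sum_neq0 (I : finType) (M : nmodType) (F : I -> M) :
  \sum_i F i != 0 -> exists i, F i != 0.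
Proof.
move=> h; apply/existsP; apply: contraNT h; rewrite negb_exists => /forallP h.
by rewrite big1 // => i _; apply/eqP; have := h i; rewrite negbK.
Qed.

Lemma sum_alt (I : finType) (M : zmodType) (F : I -> I -> M) :
  (forall a, F a a = 0) -> (forall a b, F a b = - F b a) ->
  \sum_a \sum_b F a b = 0.
Proof.
move=> h0 hC.
suff h (r : seq I) : \sum_(a <- r) \sum_(b <- r) F a b = 0 by exact: h.
elim: r => [|i r IH]; first by rewrite big_nil.
rewrite big_cons big_cons h0 add0r.
under [X in _ + X = _]eq_bigr => j _ do rewrite big_cons.
rewrite big_split /= IH addr0 -big_split big1 // => j _ /=.
by rewrite hC addNr.
Qed.

Lemma addfMz (M M' : zmodType) (f : M -> M') x z :
  {morph f : x y / x + y} -> f (x *~ z) = f x *~ z.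
Proof.
move=> fD; have f0 : f 0 = 0 by apply: (addrI (f 0)); rewrite -fD !addr0.
have fN y : f (- y) = - f y by apply/eqP; rewrite -addr_eq0 -fD addNr f0.
have fn (m : nat) : f (x *~ m) = f x *~ m.
  elim: m => [|m IH]; first by rewrite !mulr0z.
  by rewrite !intS !mulrzDr !mulr1z fD IH.
by case: z => m //; rewrite NegzE !mulrNz fN fn.
Qed.

Lemma sumMz (M : zmodType) I (r : seq I) (P : pred I) (F : I -> M) z :
  (\sum_(i <- r | P i) F i) *~ z = \sum_(i <- r | P i) F i *~ z.
Proof. by elim/big_rec2: _ => [|i x y _ <-]; rewrite ?mul0rz ?mulrzDl. Qed.

Lemma int_predK (p : int) : p = p - 1 + 1. Proof. by rewrite subrK. Qed.
Lemma int_sub_pred (q : int) : q - (q - 1) = 1. Proof. by rewrite opprB addrCA subrr addr0. Qed.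

(* G_S(W)(N), written with families v of W = V^* and v' of V, which are meant to
   be dual bases. *)
Section GFunctor.
Variables (k : fieldType) (V : vectType k).
Let W := 'Hom(V, k^o).
Let n := \dim {:V}.
Let hS := @sym_homog k (\dim {:W}).
Let hE := @ext_homog k n.
Variables (s : nat) (v : 'I_s -> W) (v' : 'I_s -> V).
Variable N : gcomplex hS.

Lemma var_homog q a : hS (q - (q - 1)) (sym_in (v a)).
Proof. by rewrite int_sub_pred; apply/sym_homogP/sym_in_homog. Qed.

(* N^p_q is a k-vector space through k = S(W)_0. *)
Definition kscale p q (c : k) (x : N p q) : N p q :=
  gact (@sym_homogC k (\dim {:W}) q c) x.

(* An element t of omega_E (x)_k N^p_q is given by its coefficients t A in the
   basis e_A^* of omega_E. *)
Definition tens p q (l : omega k n) (x : N p q) : {ffun {set 'I_n} -> N p q} :=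
  [ffun A => kscale (l (ebasis k A)) x].

(* l (x) x |-> \sum_a l v'_a (x) v_a x *)
Definition koszul p q (t : {ffun {set 'I_n} -> N p (q - 1)}) :
    {ffun {set 'I_n} -> N p q} :=
  \sum_A \sum_a tens (omega_r (estar k A) (ext_in (v' a)))
                     (gact (@var_homog q a) (t A)).

Definition eact p q (x : ext k n) (t : {ffun {set 'I_n} -> N p q}) :
    {ffun {set 'I_n} -> N p q} :=
  \sum_A tens (omega_l x (estar k A)) (t A).

(* The degree j part of the term of total degree m of the total complex, that
   is, the sum of the omega_E(q)_j (x) N^p_q for p + q = m, where
   omega_E(q)_j = (omega_E)_(q+j) has basis the e_A^* with #|A| = -(q+j). Only
   finitely many q contribute. *)
Record tot (m j : int) := Tot {
  tfam :> forall p q, {ffun {set 'I_n} -> N p q};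
  tfamP : forall p q A,
    tfam p q A != 0 -> p + q = m /\ #|A|%:Z = - (q + j) }.

Lemma totP m j (t u : tot m j) : (forall p q A, t p q A = u p q A) -> t = u.
Proof.
case: t u => [t ht] [u hu] /= e; have {}e : t = u.
  by apply: functional_extensionality_dep => p; apply: functional_extensionality_dep => q; apply/ffunP => A; exact: e.
by rewrite -e in hu *; congr Tot; apply: Prop_irrelevance.
Qed.

HB.instance Definition _ m j := gen_eqMixin (tot m j).
HB.instance Definition _ m j := gen_choiceMixin (tot m j).

Section TotZmod.
Variables m j : int.

Lemma tot0_subproof p q A : ([ffun=> 0] : {ffun {set 'I_n} -> N p q}) A != 0 ->
  p + q = m /\ #|A|%:Z = - (q + j).
Proof. by rewrite ffunE eqxx. Qed.
Definition tot0 : tot m j := Tot tot0_subproof.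

Lemma totN_subproof (t : tot m j) p q A : (- t p q) A != 0 ->
  p + q = m /\ #|A|%:Z = - (q + j).
Proof. by rewrite ffunE oppr_eq0; exact: tfamP. Qed.
Definition totN (t : tot m j) : tot m j := Tot (@totN_subproof t).

Lemma totD_subproof (t u : tot m j) p q A : (t p q + u p q) A != 0 ->
  p + q = m /\ #|A|%:Z = - (q + j).
Proof.
rewrite ffunE; have [-> |/tfamP //] := eqVneq (t p q A) 0.
by rewrite add0r => /tfamP.
Qed.
Definition totD (t u : tot m j) : tot m j := Tot (@totD_subproof t u).

Lemma totDA : associative totD.
Proof. by move=> t u w; apply: totP => p q A /=; rewrite !ffunE addrA. Qed.
Lemma totDC : commutative totD.
Proof. by move=> t u; apply: totP => p q A /=; rewrite !ffunE addrC. Qed.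
Lemma tot0D : left_id tot0 totD.
Proof. by move=> t; apply: totP => p q A /=; rewrite !ffunE add0r. Qed.
Lemma totND : left_inverse tot0 totN totD.
Proof. by move=> t; apply: totP => p q A /=; rewrite !ffunE addNr. Qed.
HB.instance Definition _ := GRing.isZmodule.Build (tot m j) totDA totDC tot0D totND.

Lemma totDE (t u : tot m j) p q A : (t + u) p q A = t p q A + u p q A.
Proof. exact: ffunE. Qed.
End TotZmod.

Lemma kscaleDr p q c (x y : N p q) : kscale c (x + y) = kscale c x + kscale c y.
Proof. exact: gactDr. Qed.
Lemma kscale0r p q c : kscale c (0 : N p q) = 0.
Proof. exact: gact0r. Qed.
Lemma kscaleDl p q c d (x : N p q) : kscale (c + d) x = kscale c x + kscale d x.
Proof.
have h := sym_homogD (@sym_homogC k (\dim {:W}) q c) (@sym_homogC k (\dim {:W}) q d).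
rewrite /kscale -(gactDl _ _ h).
by apply: gact_irr; rewrite mpolyCD.
Qed.
Lemma kscaleA p q c d (x : N p q) : kscale (c * d) x = kscale c (kscale d x).
Proof.
have h : hS (q - q) (c%:MP * d%:MP) by rewrite -mpolyCM; exact: sym_homogC.
by rewrite /kscale -(gactM _ _ h); apply: gact_irr; rewrite mpolyCM.
Qed.
Lemma kscale1 p q (x : N p q) : kscale 1 x = x.
Proof. by rewrite /kscale -[RHS](gact1 (sym_homog1 q)); apply: gact_irr; rewrite mpolyC1. Qed.
Lemma kscale0l p q (x : N p q) : kscale 0 x = 0.
Proof. by apply: (addrI (kscale 0 x)); rewrite -kscaleDl !addr0. Qed.
Lemma kscale_suml p q I (r : seq I) (P : pred I) (F : I -> k) (x : N p q) :
  kscale (\sum_(i <- r | P i) F i) x = \sum_(i <- r | P i) kscale (F i) x.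
Proof. elim/big_rec2: _ => [|i y z _ <-]; [exact: kscale0l|exact: kscaleDl]. Qed.
Lemma kscale_sumr p q c I (r : seq I) (P : pred I) (F : I -> N p q) :
  kscale c (\sum_(i <- r | P i) F i) = \sum_(i <- r | P i) kscale c (F i).
Proof. exact: gact_sumr. Qed.

Lemma kscale_gact p q q' a (ha : hS (q' - q) a) c (x : N p q) :
  gact ha (kscale c x) = kscale c (gact ha x).
Proof.
rewrite /kscale.
have h1 : hS (q' - q) (a * c%:MP).
  by rewrite -[q' - q]addr0 -(subrr q); apply: sym_homogM ha (@sym_homogC _ _ q c).
have h2 : hS (q' - q) (c%:MP * a) by rewrite mulrC.
by rewrite -(gactM _ _ h1) -(gactM _ _ h2); apply: gact_irr; rewrite mulrC.
Qed.

Lemma koszulE p q (t : {ffun {set 'I_n} -> N p (q - 1)}) B :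
  koszul t B = \sum_A \sum_a kscale ((ext_in (v' a) * ebasis k B) A)
                              (gact (@var_homog q a) (t A)).
Proof.
rewrite /koszul sum_ffunE; apply: eq_bigr => A _.
by rewrite sum_ffunE; apply: eq_bigr => a _; rewrite ffunE omega_rE estarE.
Qed.

Lemma eactE p q x (t : {ffun {set 'I_n} -> N p q}) B :
  eact x t B = \sum_A kscale ((ebasis k B * x) A) (t A).
Proof.
by rewrite /eact sum_ffunE; apply: eq_bigr => A _; rewrite ffunE omega_lE estarE.
Qed.

Lemma ext_homog_ebasis (B : {set 'I_n}) : hE #|B| (ebasis k B).
Proof. by move=> A; rewrite ffunE; have [->|_] := eqVneq A B; rewrite ?eqxx. Qed.

Lemma ext_homogM d e (x y : ext k n) : hE d x -> hE e y -> hE (d + e) (x * y).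
Proof.
move=> hx hy C; rewrite ext_mulE; apply: contraNeq => hC.
rewrite big1 // => A AC; have [->|/hx xA] := eqVneq (x A) 0.
  by rewrite mulr0 mul0r.
have [->|/hy yA] := eqVneq (y (C :\: A)) 0; first by rewrite mulr0.
case/eqP: hC; rewrite -xA -yA -PoszD cardsDS //.
by rewrite subnKC // subset_leq_card.
Qed.

Lemma ext_homog1 d : hE (d - d) 1.
Proof. by rewrite subrr; move=> A; rewrite ffunE; have [->|_] := eqVneq A set0; rewrite ?cards0 ?eqxx. Qed.

Lemma totd_subproof m m' j (h : m' = m + 1) (t : tot m j) p q A :
  [ffun A => gdiff (int_predK p) (t (p - 1) q A) +
             koszul (t p (q - 1)) A *~ (-1) ^+ `|p|%N] A != 0 ->
  p + q = m' /\ #|A|%:Z = - (q + j).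
Proof.
rewrite ffunE h.
have [e|/tfamP[e1 e2] _] := eqVneq (t (p - 1) q A) 0; last first.
  by split=> //; rewrite -e1 addrAC subrK.
rewrite e gdiff0 add0r => hk.
have {hk} : koszul (t p (q - 1)) A != 0.
  by apply: contraNneq hk => ->; rewrite mul0rz.
rewrite koszulE => /sum_neq0[B /sum_neq0[a hB]].
have /tfamP[e1 e2] : t p (q - 1) B != 0.
  by apply: contraNneq hB => ->; rewrite gact0r kscale0r.
have ha : (ext_in (v' a) * ebasis k A) B != 0.
  by apply: contraNneq hB => ->; rewrite kscale0l.
have := @ext_homogM _ _ _ _ (@ext_in_homog _ _ (v' a)) (@ext_homog_ebasis A) B ha.
by rewrite e2 -e1; lia.
Qed.

Definition totd m m' j (h : m' = m + 1) (t : tot m j) : tot m' j :=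
  Tot (@totd_subproof m m' j h t).

Lemma tota_subproof m j j' x (hx : hE (j' - j) x) (t : tot m j) p q A :
  eact x (t p q) A != 0 -> p + q = m /\ #|A|%:Z = - (q + j').
Proof.
rewrite eactE => /sum_neq0[B hB].
have /tfamP[e1 e2] : t p q B != 0.
  by apply: contraNneq hB => ->; rewrite kscale0r.
have hB' : (ebasis k A * x) B != 0.
  by apply: contraNneq hB => ->; rewrite kscale0l.
split=> //; have := @ext_homogM _ _ _ _ (@ext_homog_ebasis A) hx B hB'.
by rewrite e2; lia.
Qed.

Definition tota m j j' x (hx : hE (j' - j) x) (t : tot m j) : tot m j' :=
  Tot (@tota_subproof m j j' x hx t).

Lemma ext_mul_basis (x y : ext k n) C : (x * y) C = \sum_A x A * (ebasis k A * y) C.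
Proof.
rewrite {1}[x]ext_basisE mulr_suml sum_ffunE; apply: eq_bigr => A _.
by rewrite -scalerAl ffunE.
Qed.

Definition tot_gmod (m : int) : gmod hE.
Proof.
apply: (@GMod _ hE (fun j => tot m j) (fun j j' x hx => @tota m j j' x hx)).
- move=> j j' x hx t u; apply: totP => p q B; rewrite [LHS]/=.
  rewrite totDE /= !eactE -big_split; apply: eq_bigr => A _.
  by rewrite totDE kscaleDr.
- move=> j j' x y hx hy hxy t; apply: totP => p q B; rewrite [LHS]/=.
  rewrite totDE /= !eactE -big_split; apply: eq_bigr => A _.
  by rewrite mulrDr ffunE kscaleDl.
- move=> j h1 t; apply: totP => p q B /=; rewrite eactE (bigD1 B) //= mulr1.
  rewrite ffunE eqxx kscale1 big1 ?addr0 // => A nA.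
  by rewrite ffunE (negPf nA) kscale0l.
- move=> i j l x y hy hx hxy t; apply: totP => p q B /=; rewrite !eactE.
  under [RHS]eq_bigr => A _ do rewrite eactE kscale_sumr.
  rewrite exchange_big; apply: eq_bigr => A _ /=.
  rewrite mulrA ext_mul_basis kscale_suml; apply: eq_bigr => C _.
  by rewrite kscaleA.
Defined.

Lemma koszulD p q (t u : {ffun {set 'I_n} -> N p (q - 1)}) :
  koszul (t + u) = koszul t + koszul u.
Proof.
apply/ffunP => B; rewrite ffunE !koszulE -big_split; apply: eq_bigr => A _.
rewrite -big_split; apply: eq_bigr => a _ /=.
have -> : (t + u) A = t A + u A by rewrite ffunE.
by rewrite gactDr kscaleDr.
Qed.

Lemma koszul_sgn p q (t : {ffun {set 'I_n} -> N p (q - 1)}) z B :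
  koszul [ffun A => t A *~ z] B = koszul t B *~ z.
Proof.
pose f (t : {ffun {set 'I_n} -> N p (q - 1)}) := koszul t B.
rewrite -(@addfMz _ _ f) /f => [|x y]; last by rewrite koszulD ffunE.
congr (koszul _ _); apply/ffunP => A; rewrite ffunE.
by rewrite -(@addfMz _ _ (fun t : {ffun {set 'I_n} -> N p (q - 1)} => t A)) // => x y; rewrite ffunE.
Qed.

Lemma koszulK p q (t : {ffun {set 'I_n} -> N p (q - 1 - 1)}) C :
  koszul (koszul t) C = 0.
Proof.
rewrite koszulE.
pose y a b A := gact (@var_homog q a) (gact (@var_homog (q - 1) b) (t A)).
transitivity (\sum_B \sum_a \sum_A \sum_b
    kscale ((ext_in (v' a) * ebasis k C) B)
      (kscale ((ext_in (v' b) * ebasis k B) A) (y a b A))).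
  apply: eq_bigr => B _; apply: eq_bigr => a _.
  rewrite koszulE gact_sumr kscale_sumr; apply: eq_bigr => A _.
  rewrite gact_sumr kscale_sumr; apply: eq_bigr => b _.
  by rewrite kscale_gact.
transitivity (\sum_A \sum_a \sum_b
    kscale ((ext_in (v' b) * (ext_in (v' a) * ebasis k C)) A) (y a b A)).
  under eq_bigr => B _ do rewrite exchange_big.
  rewrite exchange_big; apply: eq_bigr => A _ /=.
  rewrite exchange_big; apply: eq_bigr => a _ /=.
  rewrite exchange_big; apply: eq_bigr => b _ /=.
  rewrite [ext_in (v' a) * _ in RHS]ext_basisE mulr_sumr sum_ffunE kscale_suml.
  apply: eq_bigr => B _; rewrite -kscaleA -scalerAr; congr (kscale _ _).
  by rewrite [RHS]ffunE.
rewrite big1 // => A _; apply: sum_alt => [a|a b].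
  by rewrite mulrA ext_in_sq mul0r ffunE kscale0l.
have -> : y a b A = y b a A.
  rewrite /y.
  have h : hS (q - (q - 1 - 1)) (sym_in (v a) * sym_in (v b)).
    rewrite (_ : q - _ = (q - (q - 1)) + (q - 1 - (q - 1 - 1))); last by lia.
    exact: sym_homogM (@var_homog q a) (@var_homog (q - 1) b).
  have h' : hS (q - (q - 1 - 1)) (sym_in (v b) * sym_in (v a)).
    by rewrite mulrC.
  by rewrite -(gactM _ _ h) -(gactM _ _ h'); apply: gact_irr; rewrite mulrC.
apply/eqP; rewrite -addr_eq0 -kscaleDl.
rewrite !mulrA [ext_in (v' b) * _]ext_in_anti mulNr.
by rewrite [X in kscale (X + _) _]ffunE addNr kscale0l.
Qed.

Lemma gdiff_kscale p p' q (h : p' = p + 1) c (x : N p q) :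
  gdiff h (kscale c x) = kscale c (gdiff h x).
Proof. exact: gdiffZ. Qed.

Lemma gdiff_koszul p p' q (h : p' = p + 1) (t : {ffun {set 'I_n} -> N p (q - 1)}) B :
  gdiff h (koszul t B) = koszul [ffun A => gdiff h (t A)] B.
Proof.
rewrite !koszulE gdiff_sum; apply: eq_bigr => A _.
rewrite gdiff_sum; apply: eq_bigr => a _.
rewrite gdiff_kscale gdiffZ; congr (kscale _ (gact _ _)).
by rewrite [RHS]ffunE.
Qed.

Lemma gdiff_sgn p p' q (h : p' = p + 1) z (x : N p q) :
  gdiff h (x *~ z) = gdiff h x *~ z.
Proof.
by apply: addfMz => y w; rewrite gdiffD.
Qed.

Lemma totdE m m' j (h : m' = m + 1) (t : tot m j) p q A :
  totd h t p q A = gdiff (int_predK p) (t (p - 1) q A) +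
             koszul (t p (q - 1)) A *~ (-1) ^+ `|p|%N.
Proof. exact: ffunE. Qed.

Lemma koszul_eact p q x (t : {ffun {set 'I_n} -> N p (q - 1)}) B :
  koszul (eact x t) B = eact x (koszul t) B.
Proof.
rewrite koszulE eactE.
transitivity (\sum_A \sum_a \sum_C
    kscale ((ext_in (v' a) * ebasis k B) A * (ebasis k A * x) C)
      (gact (@var_homog q a) (t C))).
  apply: eq_bigr => A _; apply: eq_bigr => a _.
  rewrite eactE gact_sumr kscale_sumr; apply: eq_bigr => C _.
  by rewrite kscale_gact -kscaleA.
transitivity (\sum_A \sum_C \sum_a
    kscale ((ebasis k B * x) A * (ext_in (v' a) * ebasis k A) C)
      (gact (@var_homog q a) (t C))); last first.
  apply: eq_bigr => A _; rewrite koszulE kscale_sumr; apply: eq_bigr => C _.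
  by rewrite kscale_sumr; apply: eq_bigr => a _; rewrite kscaleA.
rewrite exchange_big [RHS]exchange_big [RHS](eq_bigr _ (fun _ _ => exchange_big _ _ _ _ _ _)) /=.
rewrite [RHS]exchange_big; apply: eq_bigr => a _ /=.
rewrite exchange_big; apply: eq_bigr => C _ /=.
rewrite -!kscale_suml; congr (kscale _ _).
rewrite -ext_mul_basis -mulrA {1}[ebasis k B * x]ext_basisE mulr_sumr sum_ffunE.
by apply: eq_bigr => A _; rewrite -scalerAr [LHS]ffunE.
Qed.

Lemma totd_is_additive m m' j (h : m' = m + 1) (t u : tot m j) :
  totd h (t + u) = totd h t + totd h u.
Proof.
apply: totP => p q A; rewrite totDE !totdE totDE gdiffD.
have -> : (t + u) p (q - 1) = t p (q - 1) + u p (q - 1) by [].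
by rewrite koszulD [in LHS]ffunE mulrzDl addrACA.
Qed.

Lemma totd_tota m m' (h : m' = m + 1) j j' x (hx : hE (j' - j) x) (t : tot m j) :
  totd h (tota hx t) = tota hx (totd h t).
Proof.
apply: totP => p q B; rewrite totdE /=.
rewrite (_ : eact x (t (p - 1) q) B = \sum_A kscale ((ebasis k B * x) A) (t (p - 1) q A)); last exact: eactE.
rewrite koszul_eact !eactE gdiff_sum.
rewrite [in RHS](eq_bigr (fun A => gdiff (int_predK p) (kscale ((ebasis k B * x) A) (t (p - 1) q A)) +
   kscale ((ebasis k B * x) A) (koszul (t p (q - 1)) A) *~ (-1) ^+ `|p|%N)) => [|A _].
  rewrite big_split; congr (_ + _).
  by rewrite sumMz.
rewrite [X in kscale _ X]ffunE kscaleDr gdiff_kscale; congr (_ + _).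
by apply: (@addfMz _ _ (kscale _)) => y w; rewrite kscaleDr.
Qed.

Lemma totdK m m' m'' j (h : m' = m + 1) (h' : m'' = m' + 1) (t : tot m j) :
  totd h' (totd h t) = 0.
Proof.
apply: totP => p q B; rewrite totdE totdE gdiffD gdiffK add0r.
rewrite (_ : totd h t p (q - 1) =
  [ffun A => gdiff (int_predK p) (t (p - 1) (q - 1) A)] +
  [ffun A => koszul (t p (q - 1 - 1)) A *~ (-1) ^+ `|p|%N]); last first.
  by apply/ffunP => A; rewrite totdE !ffunE.
rewrite koszulD [X in _ + X *~ _]ffunE koszul_sgn koszulK mul0rz addr0.
rewrite gdiff_sgn gdiff_koszul -mulrzDr.
rewrite (_ : (-1) ^+ `|p - 1| + (-1) ^+ `|p| = 0 :> int) ?mulr0z ?ffunE //.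
have -> : (-1) ^+ `|p - 1| = - (-1) ^+ `|p| :> int; last by rewrite addNr.
rewrite -signr_odd -[X in _ = - X]signr_odd.
have -> : odd `|p - 1| = ~~ odd `|p| by lia.
by case: odd; rewrite ?expr1 ?expr0 ?opprK.
Qed.

(* The complex G_S(W)(N) of graded left E(V)-modules; the two differentials
   commute, whence the sign (-1)^p in the total complex. *)
Definition G_S : gcomplex hE :=
  @GComplex _ hE tot_gmod (fun m m' j h t => @totd m m' j h t)
    (fun m m' j h => @totd_is_additive m m' j h)
    (fun m m' h j j' x hx => @totd_tota m m' h j j' x hx)
    (fun m m' m'' j h h' => @totdK m m' m'' j h h').

End GFunctor.

From mathcomp Require Import classical_sets cardinality.
Local Open Scope classical_set_scope.
Local Open Scope ring_scope.

(* The projective space P(W) = Proj k[x_0, .., x_(n-1)]. *)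
Section Proj.
Variables (k : fieldType) (n : nat).
Local Notation S := {mpoly k[n]}.
Definition ratfun : fieldType := {fraction S}.
Definition emb (a : S) : ratfun := tofrac a.

(* Homogeneous prime ideals that do not contain the irrelevant ideal. *)
Record proj_pt := ProjPt {
  pideal :> S -> Prop;
  pideal0 : pideal 0;
  pidealD : forall a b, pideal a -> pideal b -> pideal (a + b);
  pidealM : forall a b, pideal b -> pideal (a * b);
  pideal1 : ~ pideal 1;
  pideal_prime : forall a b, pideal (a * b) -> pideal a \/ pideal b;
  pideal_homog : forall a d, pideal a -> pideal (pihomog mdeg d a);
  pideal_relevant : exists d a, [/\ (0 < d)%N, a \is d.-homog & ~ pideal a] }.

Definition zariski_open (U : set proj_pt) : Prop :=
  exists E : set S, (forall a, E a -> exists d : nat, a \is d.-homog) /\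
    U = [set x : proj_pt | exists2 a, E a & ~ x a].

Record opens := Opens { oset :> proj_pt -> Prop; osetP : zariski_open oset }.

Lemma embD a b : emb (a + b) = emb a + emb b. Proof. exact: tofracD. Qed.
Lemma embM a b : emb (a * b) = emb a * emb b. Proof. exact: tofracM. Qed.
Lemma embN a : emb (- a) = - emb a. Proof. exact: tofracN. Qed.
Lemma emb0 : emb 0 = 0. Proof. exact: tofrac0. Qed.
Lemma emb1 : emb 1 = 1. Proof. exact: tofrac1. Qed.

Local Notation "V `<=o` U" := (subset (oset V) (oset U)) (at level 70).

(* Sections over U of the sheaf associated with S(d), Hartshorne's way: an
   element of the localization S_(x), seen in Frac S, for each x in U, which is
   locally a fraction of homogeneous elements with difference of degrees d.
   They are extended by 0 outside of U. *)
Definition is_regular (d : int) (U : opens) (g : proj_pt -> ratfun) : Prop :=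
  (forall x, ~ U x -> g x = 0) /\
  forall x, U x -> exists (V : opens) (a f : S) (e : int),
    [/\ V x, V `<=o` U, sym_homog (d + e) a, sym_homog e f &
        forall y, V y -> ~ y f /\ g y = emb a / emb f].

Record tws (d : int) (U : opens) := Tws {
  twsf :> proj_pt -> ratfun; twsP : is_regular d U twsf }.

Lemma tws_ext d U (g h : tws d U) : (forall x, U x -> g x = h x) -> g = h.
Proof.
case: g h => [g hg] [h hh] /= e; have {}e : g = h.
  apply: funext => x; have [/e //|nU] := pselect (U x).
  by rewrite hg.1 // hh.1.
by rewrite -e in hh *; congr Tws; apply: Prop_irrelevance.
Qed.

HB.instance Definition _ d U := gen_eqMixin (tws d U).
HB.instance Definition _ d U := gen_choiceMixin (tws d U).

Lemma openI_subproof (U V : opens) : zariski_open (fun x => U x /\ V x).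
Proof.
have [E [hE ->]] := osetP U; have [F [hF ->]] := osetP V.
exists [set c | exists a b, [/\ E a, F b & c = a * b]]; split.
  move=> _ [a [b [/hE[d ad] /hF[e be] ->]]].
  by exists (d + e)%N; apply: dhomogM.
apply/seteqP; split=> x /=.
  move=> [[a Ea xa] [b Fb xb]]; exists (a * b); first by exists a, b.
  by case/pideal_prime.
move=> [_ [a [b [Ea Fb ->]]] xab]; split; [exists a => //|exists b => //].
- by move=> xa; apply: xab; rewrite mulrC; apply: pidealM.
- by move=> xb; apply: xab; apply: pidealM.
Qed.
Definition openI U V := Opens (openI_subproof U V).

Lemma openT_subproof : zariski_open (fun=> True).
Proof.
exists [set a | exists d : nat, a \is d.-homog]; split=> //.
apply/seteqP; split=> // x _; exists 1; first by exists 0%N; exact: dhomog1.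
exact: pideal1.
Qed.
Definition openT := Opens openT_subproof.

Lemma emb_neq0 (x : proj_pt) (f : S) : ~ x f -> emb f != 0.
Proof. move=> xf; rewrite (tofrac_eq0 f : (emb f == 0) = _); apply: contra_notN xf => /eqP ->; exact: pideal0. Qed.

Lemma pidealMn (x : proj_pt) (f g : S) : ~ x f -> ~ x g -> ~ x (f * g).
Proof. by move=> xf xg /pideal_prime[]. Qed.

Section TwsZmod.
Variables (d : int) (U : opens).

Lemma reg0 : is_regular d U (fun=> 0).
Proof.
split=> // x Ux; exists U, 0, 1, 0; split=> //; first exact: sym_homog0.
  by rewrite -(subrr 0); exact: sym_homog1.
by move=> y _; split; [exact: pideal1|rewrite emb0 mul0r].
Qed.

Lemma regN (g : tws d U) : is_regular d U (fun x => - g x).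
Proof.
case: g => g [g0 g1] /=; split=> [x /g0 ->|x /g1]; first by rewrite oppr0.
move=> [V [a [f [e [Vx VU ha hf h]]]]]; exists V, (- a), f, e; split=> //.
  exact: sym_homogN.
by move=> y /h[yf ->]; rewrite embN mulNr.
Qed.

Lemma regD (g h : tws d U) : is_regular d U (fun x => g x + h x).
Proof.
case: g h => [g [g0 g1]] [h [h0 h1]] /=; split=> [x nU|x Ux].
  by rewrite g0 // h0 // addr0.
have [V [a [f [e [Vx VU ha hf hV]]]]] := g1 x Ux.
have [W [b [f' [e' [Wx WU hb hf' hW]]]]] := h1 x Ux.
exists (openI V W), (a * f' + b * f), (f * f'), (e + e'); split=> //.
- by move=> y [/VU].
- apply: sym_homogD; first by rewrite addrA; apply: sym_homogM.
  by rewrite [e + e']addrC addrA; apply: sym_homogM.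
- exact: sym_homogM.
- move=> y [/hV[yf ->] /hW[yf' ->]]; split; first exact: pidealMn.
  rewrite embD !embM addf_div; first reflexivity.
    exact: (emb_neq0 yf).
  exact: (emb_neq0 yf').
Qed.

Let add (g h : tws d U) := Tws (regD g h).
Let opp (g : tws d U) := Tws (regN g).
Lemma twsA : associative add.
Proof. by move=> f g h; apply: tws_ext => x _ /=; rewrite addrA. Qed.
Lemma twsC : commutative add.
Proof. by move=> f g; apply: tws_ext => x _ /=; rewrite addrC. Qed.
Lemma tws0 : left_id (Tws reg0) add.
Proof. by move=> f; apply: tws_ext => x _ /=; rewrite add0r. Qed.
Lemma twsN : left_inverse (Tws reg0) opp add.
Proof. by move=> f; apply: tws_ext => x _ /=; rewrite addNr. Qed.
HB.instance Definition _ := GRing.isZmodule.Build (tws d U) twsA twsC tws0 twsN.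
End TwsZmod.

Lemma regM d e U (g : tws d U) (h : tws e U) : is_regular (d + e) U (fun x => g x * h x).
Proof.
case: g h => [g [g0 g1]] [h [h0 h1]] /=; split=> [x nU|x Ux].
  by rewrite g0 // mul0r.
have [V [a [f [i [Vx VU ha hf hV]]]]] := g1 x Ux.
have [W [b [f' [i' [Wx WU hb hf' hW]]]]] := h1 x Ux.
exists (openI V W), (a * b), (f * f'), (i + i'); split=> //.
- by move=> y [/VU].
- by rewrite addrACA; apply: sym_homogM.
- exact: sym_homogM.
- move=> y [/hV[yf ->] /hW[yf' ->]]; split; first exact: pidealMn.
  by rewrite mulf_div !embM.
Qed.

(* The structure sheaf. *)
Definition OP (U : opens) : Type := tws 0 U.
HB.instance Definition _ U := GRing.Zmodule.on (OP U).

Lemma reg1 U : is_regular 0 U (fun x => if `[< U x >] then 1 else 0).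
Proof.
split=> [x nU|x Ux]; first by case: asboolP.
exists U, 1, 1, 0; split=> //; try by rewrite -(subrr 0); exact: sym_homog1.
by move=> y Uy; rewrite asboolT // emb1 divr1; split=> //; exact: pideal1.
Qed.

Section TwsRing.
Variable U : opens.
Let mul (g h : OP U) : OP U := Tws (regM g h).
Let one : OP U := Tws (reg1 U).
Lemma OmulA : associative mul.
Proof. by move=> f g h; apply: tws_ext => x _ /=; rewrite mulrA. Qed.
Lemma OmulC : commutative mul.
Proof. by move=> f g; apply: tws_ext => x _ /=; rewrite mulrC. Qed.
Lemma Omul1 : left_id one mul.
Proof. by move=> f; apply: tws_ext => x Ux /=; rewrite asboolT // mul1r. Qed.
Lemma OmulD : left_distributive mul +%R.
Proof. by move=> f g h; apply: tws_ext => x _ /=; rewrite mulrDl. Qed.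
HB.instance Definition _ :=
  GRing.Zmodule_isComPzRing.Build (OP U) OmulA OmulC Omul1 OmulD.
End TwsRing.

Lemma regZ d U (a : OP U) (g : tws d U) : is_regular d U (fun x => a x * g x).
Proof. by have := regM a g; rewrite add0r. Qed.

Section TwsLmod.
Variables (d : int) (U : opens).
Let scale (a : OP U) (g : tws d U) := Tws (regZ a g).
Lemma twsZA a b g : scale a (scale b g) = scale (a * b) g.
Proof. by apply: tws_ext => x _ /=; rewrite mulrA. Qed.
Lemma twsZ1 : left_id 1 scale.
Proof. by move=> f; apply: tws_ext => x Ux /=; rewrite asboolT // mul1r. Qed.
Lemma twsZDr : right_distributive scale +%R.
Proof. by move=> a f g; apply: tws_ext => x _ /=; rewrite mulrDr. Qed.
Lemma twsZDl g : {morph scale^~ g : a b / a + b}.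
Proof. by move=> a b; apply: tws_ext => x _ /=; rewrite mulrDl. Qed.
HB.instance Definition _ :=
  GRing.Zmodule_isLmodule.Build (OP U) (tws d U) twsZA twsZ1 twsZDr twsZDl.
End TwsLmod.

Lemma reg_res d U V (g : tws d U) : V `<=o` U ->
  is_regular d V (fun x => if `[< V x >] then g x else 0).
Proof.
case: g => g [g0 g1] /= VU; split=> [x nV|x Vx]; first by case: asboolP.
have [W [a [f [e [Wx WU ha hf hW]]]]] := g1 x (VU x Vx).
exists (openI V W), a, f, e; split=> //; first by move=> y [].
by move=> y [Vy /hW]; rewrite asboolT.
Qed.
Definition tws_res d U V (VU : V `<=o` U) (g : tws d U) : tws d V :=
  Tws (reg_res g VU).
Definition Ores U V (VU : V `<=o` U) (a : OP U) : OP V := tws_res VU a.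

(* Sheaves of O-modules. *)
Record omod := OMod {
  osec :> forall U : opens, lmodType (OP U);
  ores : forall U V : opens, V `<=o` U -> osec U -> osec V;
  oresD : forall U V (VU : V `<=o` U) x y, ores VU (x + y) = ores VU x + ores VU y;
  oresZ : forall U V (VU : V `<=o` U) a x,
    ores VU (a *: x) = Ores VU a *: ores VU x;
  ores_id : forall U (UU : U `<=o` U) x, ores UU x = x;
  ores_comp : forall U V W (VU : V `<=o` U) (WV : W `<=o` V) (WU : W `<=o` U) x,
    ores WV (ores VU x) = ores WU x;
  osep : forall (U : opens) I (C : I -> opens) (CU : forall i, C i `<=o` U),
    (forall x, U x -> exists i, C i x) ->
    forall x y, (forall i, ores (CU i) x = ores (CU i) y) -> x = y;
  oglue : forall (U : opens) I (C : I -> opens) (CU : forall i, C i `<=o` U),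
    (forall x, U x -> exists i, C i x) ->
    forall x : forall i, osec (C i),
    (forall i j (W : opens) (Wi : W `<=o` C i) (Wj : W `<=o` C j),
       ores Wi (x i) = ores Wj (x j)) ->
    exists y, forall i, ores (CU i) y = x i }.

Lemma tws_glue d (U : opens) I (C : I -> opens) (CU : forall i, C i `<=o` U) :
  (forall x, U x -> exists i, C i x) ->
  forall g : forall i, tws d (C i),
  (forall i j (W : opens) (Wi : W `<=o` C i) (Wj : W `<=o` C j),
     tws_res Wi (g i) = tws_res Wj (g j)) ->
  exists h, forall i, tws_res (CU i) h = g i.
Proof.
move=> cov g gg.
have gE i j x : C i x -> C j x -> g i x = g j x.
  move=> ix jx.
  have := gg i j (openI (C i) (C j)) (fun _ w => proj1 w) (fun _ w => proj2 w).
  move=> e; have := congr1 (fun w : tws d _ => twsf w x) e; rewrite /= !asboolT //.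
pose h x := if pselect (exists i, C i x) is left e then g (projT1 (cid e)) x else 0.
have hE i x : C i x -> h x = g i x.
  rewrite /h => ix; case: pselect => [e|[]]; last by exists i.
  exact: gE (projT2 (cid e)) ix.
have hr : is_regular d U h.
  split=> [x nU|x /cov[i ix]].
    by rewrite /h; case: pselect => // e; case: nU; have [i ix] := e; exact: (CU i).
  have [V [a [f [e [Vx VC ha hf hV]]]]] := (twsP (g i)).2 x ix.
  exists V, a, f, e; split=> //; first by move=> y /VC /CU.
  by move=> y Vy; have [yf gy] := hV y Vy; rewrite (hE i y (VC y Vy)).
exists (Tws hr) => i; apply: tws_ext => x ix /=.
by rewrite asboolT //; exact: hE.
Qed.

(* The twisting sheaf O(d). *)
Definition twisting (d : int) : omod.
Proof.
apply: (@OMod (fun U => tws d U) (fun U V VU => @tws_res d U V VU)).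
- by move=> U V VU g h; apply: tws_ext => x Vx /=; rewrite asboolT.
- by move=> U V VU a g; apply: tws_ext => x Vx /=; rewrite asboolT.
- by move=> U UU g; apply: tws_ext => x Vx /=; rewrite asboolT.
- move=> U V W VU WV WU g; apply: tws_ext => x Wx /=.
  by rewrite asboolT // asboolT //; exact: WV.
- move=> U I C CU cov g h gh; apply: tws_ext => x /cov[i ix].
  have := congr1 (fun w : tws d _ => twsf w x) (gh i); rewrite /= !asboolT //.
- exact: tws_glue.
Defined.

(* phi is a morphism of sheaves of modules F|_U -> G|_U (its values over opens
   not contained in U are irrelevant). *)
Definition ohom (U : opens) (F G : omod) (phi : forall V, F V -> G V) : Prop :=
  [/\ forall V, V `<=o` U -> forall x y, phi V (x + y) = phi V x + phi V y,
      forall V, V `<=o` U -> forall a x, phi V (a *: x) = a *: phi V x &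
      forall V W (WV : W `<=o` V), V `<=o` U ->
        forall x, phi W (ores WV x) = ores WV (phi V x)].

Definition omorphism := ohom openT.

Definition mono_on (U : opens) (F G : omod) (phi : forall V, F V -> G V) : Prop :=
  forall V, V `<=o` U -> injective (phi V).

Definition epi_on (U : opens) (F G : omod) (phi : forall V, F V -> G V) : Prop :=
  forall V, V `<=o` U -> forall (y : G V) x, V x ->
  exists (W : opens) (WV : W `<=o` V) (z : F W), W x /\ phi W z = ores WV y.

(* Exactness at G over U of F -> G -> H, as sheaves. *)
Definition exact_on (U : opens) (F G H : omod)
    (phi : forall V, F V -> G V) (psi : forall V, G V -> H V) : Prop :=
  (forall V, V `<=o` U -> forall x, psi V (phi V x) = 0) /\
  (forall V, V `<=o` U -> forall y : G V, psi V y = 0 -> forall x, V x ->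
    exists (W : opens) (WV : W `<=o` V) (z : F W), W x /\ phi W z = ores WV y).


(* The sheaf G^(I), direct sum of copies of G indexed by I: locally finite
   families of sections of G. *)
Section Copower.
Variables (G : omod) (I : Type).

Definition locally_finite (U : opens) (c : I -> G U) : Prop :=
  forall x, U x -> exists (W : opens) (WU : W `<=o` U),
    W x /\ finite_set [set i | ores WU (c i) <> 0].

Record copsec (U : opens) := Cop {
  copf :> I -> G U; copP : locally_finite copf }.

Lemma cop_ext U (c d : copsec U) : (forall i, c i = d i) -> c = d.
Proof.
case: c d => [c hc] [d hd] /= /funext e.
by rewrite -e in hd *; congr Cop; apply: Prop_irrelevance.
Qed.

HB.instance Definition _ U := gen_eqMixin (copsec U).
HB.instance Definition _ U := gen_choiceMixin (copsec U).

Lemma ores0 (F : omod) U V (VU : V `<=o` U) : ores VU (0 : F U) = 0.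
Proof. by apply: (addrI (ores VU 0)); rewrite -oresD !addr0. Qed.
Lemma oresN (F : omod) U V (VU : V `<=o` U) (x : F U) : ores VU (- x) = - ores VU x.
Proof. by apply/eqP; rewrite -addr_eq0 -oresD addNr ores0. Qed.

Lemma ores_irr (F : omod) U V (VU VU' : V `<=o` U) (x : F U) : ores VU x = ores VU' x.
Proof. by congr ores; apply: Prop_irrelevance. Qed.

Lemma lf0 U : locally_finite (fun _ : I => 0 : G U).
Proof.
move=> x Ux; exists U, (fun _ h => h); split=> //.
have -> : [set i : I | ores (fun _ h => h) (0 : G U) <> 0] = set0.
  by apply/seteqP; split=> // i /=; rewrite ores0.
exact: finite_set0.
Qed.

Lemma lfN U (c : copsec U) : locally_finite (fun i => - c i).
Proof.
move=> x /(copP c)[W [WU [Wx fW]]]; exists W, WU; split=> //.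
apply: sub_finite_set fW => i /=; rewrite oresN => h e; apply: h.
by rewrite e oppr0.
Qed.

Lemma lfD U (c d : copsec U) : locally_finite (fun i => c i + d i).
Proof.
move=> x Ux; have [W [WU [Wx fW]]] := copP c Ux.
have [W' [WU' [Wx' fW']]] := copP d Ux.
have i1 : openI W W' `<=o` W by move=> y [].
have i2 : openI W W' `<=o` W' by move=> y [].
have iU : openI W W' `<=o` U by move=> y [/WU].
exists (openI W W'), iU; split=> //.
have : finite_set ([set i | ores WU (c i) <> 0] `|` [set i | ores WU' (d i) <> 0]).
  by rewrite finite_setU.
apply: sub_finite_set => i /=; rewrite oresD => h.
have [e|] := pselect (ores WU (c i) = 0); last by left.
right=> e'; apply: h.
by rewrite -(ores_comp WU i1) -(ores_comp WU' i2) e e' !ores0 addr0.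
Qed.

Lemma lfZ U (a : OP U) (c : copsec U) : locally_finite (fun i => a *: c i).
Proof.
move=> x /(copP c)[W [WU [Wx fW]]]; exists W, WU; split=> //.
apply: sub_finite_set fW => i /=; rewrite oresZ => h e; apply: h.
by rewrite e scaler0.
Qed.

Section CopZmod.
Variable U : opens.
Let add (c d : copsec U) := Cop (lfD c d).
Let opp (c : copsec U) := Cop (lfN c).
Let scale (a : OP U) (c : copsec U) := Cop (lfZ a c).
Lemma copA : associative add.
Proof. by move=> f g h; apply: cop_ext => x /=; rewrite addrA. Qed.
Lemma copC : commutative add.
Proof. by move=> f g; apply: cop_ext => x /=; rewrite addrC. Qed.
Lemma cop0 : left_id (Cop (@lf0 U)) add.
Proof. by move=> f; apply: cop_ext => x /=; rewrite add0r. Qed.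
Lemma copN : left_inverse (Cop (@lf0 U)) opp add.
Proof. by move=> f; apply: cop_ext => x /=; rewrite addNr. Qed.
HB.instance Definition _ := GRing.isZmodule.Build (copsec U) copA copC cop0 copN.
Lemma copZA a b g : scale a (scale b g) = scale (a * b) g.
Proof. by apply: cop_ext => x /=; rewrite scalerA. Qed.
Lemma copZ1 : left_id 1 scale.
Proof. by move=> f; apply: cop_ext => x /=; rewrite scale1r. Qed.
Lemma copZDr : right_distributive scale +%R.
Proof. by move=> a f g; apply: cop_ext => x /=; rewrite scalerDr. Qed.
Lemma copZDl g : {morph scale^~ g : a b / a + b}.
Proof. by move=> a b; apply: cop_ext => x /=; rewrite scalerDl. Qed.
HB.instance Definition _ :=
  GRing.Zmodule_isLmodule.Build (OP U) (copsec U) copZA copZ1 copZDr copZDl.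
End CopZmod.

Lemma lf_res U V (VU : V `<=o` U) (c : copsec U) :
  locally_finite (fun i => ores VU (c i)).
Proof.
move=> x Vx; have [W [WU [Wx fW]]] := copP c (VU x Vx).
have i1 : openI W V `<=o` W by move=> y [].
have i2 : openI W V `<=o` V by move=> y [].
have iU : openI W V `<=o` U by move=> y [/WU].
exists (openI W V), i2; split=> //; apply: sub_finite_set fW => i /= h e.
by apply: h; rewrite (ores_comp VU i2 iU) -(ores_comp WU i1 iU) e ores0.
Qed.
Definition cop_res U V (VU : V `<=o` U) (c : copsec U) : copsec V :=
  Cop (lf_res VU c).

Lemma cop_glue (U : opens) J (C : J -> opens) (CU : forall i, C i `<=o` U) :
  (forall x, U x -> exists i, C i x) ->
  forall g : forall i, copsec (C i),
  (forall i j (W : opens) (Wi : W `<=o` C i) (Wj : W `<=o` C j),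
     cop_res Wi (g i) = cop_res Wj (g j)) ->
  exists h, forall i, cop_res (CU i) h = g i.
Proof.
move=> cov g gg.
have gl a : exists y, forall i, ores (CU i) y = g i a.
  apply: oglue cov _ _ => i j W Wi Wj.
  by have := congr1 (fun c : copsec W => c a) (gg i j W Wi Wj).
have lf : locally_finite (fun a => projT1 (cid (gl a))).
  move=> x /cov[i ix]; have [W [WC [Wx fW]]] := copP (g i) ix.
  have WU : W `<=o` U by move=> y /WC /CU.
  exists W, WU; split=> //; apply: sub_finite_set fW => a /= h e; apply: h.
  by rewrite -(ores_comp (CU i) WC) (projT2 (cid (gl a))).
by exists (Cop lf) => i; apply: cop_ext => a /=; rewrite (projT2 (cid (gl a))).
Qed.

Definition copower : omod.
Proof.
apply: (@OMod (fun U => copsec U) (fun U V VU => @cop_res U V VU)).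
- by move=> U V VU c d; apply: cop_ext => i /=; rewrite oresD.
- by move=> U V VU a c; apply: cop_ext => i /=; rewrite oresZ.
- by move=> U UU c; apply: cop_ext => i /=; rewrite ores_id.
- by move=> U V W VU WV WU c; apply: cop_ext => i /=; rewrite ores_comp.
- move=> U J C CU cov c d cd; apply: cop_ext => a; apply: osep cov _ _ _ => i.
  by have := congr1 (fun c : copsec _ => c a) (cd i).
- exact: cop_glue.
Defined.
End Copower.

Definition free_sheaf (I : Type) : omod := copower (twisting 0) I.

Definition quasi_coherent (F : omod) : Prop :=
  forall x, exists (U : opens) (I J : Type)
    (phi : forall V, free_sheaf J V -> free_sheaf I V) (psi : forall V, free_sheaf I V -> F V),
  [/\ U x, ohom U phi, ohom U psi, exact_on U phi psi & epi_on U psi].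

(* The subsheaf P of F|_U is of finite type. *)
Definition finite_type_on (U : opens) (F : omod) (P : forall V, F V -> Prop) :=
  forall x, U x -> exists (V : opens) (m : nat) (s : 'I_m -> F V),
  [/\ V x, V `<=o` U, forall i, P V (s i) &
      forall (W : opens) (WV : W `<=o` V) (t : F W), P W t ->
      forall y, W y -> exists (Z : opens) (ZW : Z `<=o` W) (ZV : Z `<=o` V)
        (c : 'I_m -> OP Z),
        Z y /\ ores ZW t = \sum_i c i *: ores ZV (s i)].

Definition coherent (F : omod) : Prop :=
  finite_type_on openT (fun V (_ : F V) => True) /\
  forall (U : opens) (m : nat) (phi : forall V, free_sheaf 'I_m V -> F V),
    ohom U phi -> finite_type_on U (fun V t => phi V t = 0).

Definition zero_sheaf (F : omod) : Prop := forall U (x : F U), x = 0.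

Record ocomplex := OComplex {
  oterm :> int -> omod;
  odiff : forall p p', p' = p + 1 -> forall U, oterm p U -> oterm p' U;
  odiffP : forall p p' (h : p' = p + 1), omorphism (odiff h);
  odiffK : forall p p' p'' (h : p' = p + 1) (h' : p'' = p' + 1) U x,
    odiff h' (@odiff p p' h U x) = 0 }.

Arguments odiff Q [p p'] h [U] x : rename.

(* H is a cohomology sheaf of F' -d-> F -d'-> F'': the cokernel of the map
   F' -> Ker d'. *)
Definition is_cohomology (F' F F'' : omod) (d : forall U, F' U -> F U)
    (d' : forall U, F U -> F'' U) (H : omod) : Prop :=
  exists (Z : omod) (i : forall U, Z U -> F U) (b : forall U, F' U -> Z U)
    (pi : forall U, Z U -> H U),
  [/\ [/\ omorphism i, mono_on openT i & exact_on openT i d'],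
      omorphism b /\ (forall U x, i U (b U x) = d U x),
      omorphism pi, exact_on openT b pi & epi_on openT pi].

(* Complexes of quasi-coherent sheaves with coherent cohomology sheaves, only
   finitely many of them nonzero. *)
Definition in_D_b_coh (Q : ocomplex) : Prop :=
  (forall p, quasi_coherent (Q p)) /\
  exists H : int -> omod,
  [/\ forall p p0 p2 (h : p = p0 + 1) (h' : p2 = p + 1),
        is_cohomology (odiff Q h) (odiff Q h') (H p),
      forall p, coherent (H p) &
      exists m : nat, forall p : int, (m < `|p|)%N -> zero_sheaf (H p)].

Definition chain_map (Q I : ocomplex) (f : forall p U, Q p U -> I p U) : Prop :=
  (forall p, omorphism (f p)) /\
  forall p p' (h : p' = p + 1) U (x : Q p U),
    f p' U (odiff Q h x) = odiff I h (f p U x).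

(* f induces monomorphisms, respectively epimorphisms, of cohomology sheaves:
   a cycle is a local boundary if its image is one, and every cycle of the
   target is locally the sum of the image of a cycle and of a boundary. *)
Definition quasi_iso (Q I : ocomplex) (f : forall p U, Q p U -> I p U) : Prop :=
  forall p0 p p2 (h : p = p0 + 1) (h' : p2 = p + 1) U,
  (forall z : Q p U, odiff Q h' z = 0 ->
     (forall x, U x -> exists (V : opens) (VU : V `<=o` U) (y : I p0 V),
        V x /\ ores VU (f p U z) = odiff I h y) ->
     forall x, U x -> exists (V : opens) (VU : V `<=o` U) (y : Q p0 V),
       V x /\ ores VU z = odiff Q h y) /\
  (forall w : I p U, odiff I h' w = 0 -> forall x, U x ->
     exists (V : opens) (VU : V `<=o` U) (z : Q p V) (y : I p0 V),
     [/\ V x, odiff Q h' z = 0 & ores VU w = f p V z + odiff I h y]).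

(* Injective objects of the category of quasi-coherent sheaves. *)
Definition qc_injective (J : omod) : Prop :=
  quasi_coherent J /\
  forall (A B : omod) (i : forall U, A U -> B U) (g : forall U, A U -> J U),
    quasi_coherent A -> quasi_coherent B ->
    omorphism i -> mono_on openT i -> omorphism g ->
    exists h : forall U, B U -> J U,
      omorphism h /\ forall U x, h U (i U x) = g U x.

Definition injective_resolution (Q I : ocomplex) (f : forall p U, Q p U -> I p U) :=
  [/\ chain_map f, quasi_iso f, forall p, qc_injective (I p) &
      exists m : int, forall p, p < m -> zero_sheaf (I p)].

(* Tensor products of sheaves of modules, by their universal property; tlift b
   is meaningful for bilinear b only. *)
Definition obilinear (F G T : omod) (b : forall U, F U -> G U -> T U) : Prop :=
  [/\ forall U x x' g, b U (x + x') g = b U x g + b U x' g,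
      forall U x g g', b U x (g + g') = b U x g + b U x g',
      forall U a x g, b U (a *: x) g = a *: b U x g,
      forall U a x g, b U x (a *: g) = a *: b U x g &
      forall U V (VU : V `<=o` U) x g,
        ores VU (b U x g) = b V (ores VU x) (ores VU g)].

Record tensor (F G : omod) := Tensor {
  tobj :> omod;
  tpair : forall U, F U -> G U -> tobj U;
  tpairP : obilinear tpair;
  tlift : forall T : omod, (forall U, F U -> G U -> T U) ->
    forall U, tobj U -> T U;
  tliftP : forall (T : omod) (b : forall U, F U -> G U -> T U),
    obilinear b -> omorphism (tlift b);
  tlift_pair : forall (T : omod) (b : forall U, F U -> G U -> T U), obilinear b ->
    forall U x g, tlift b (@tpair U x g) = b U x g;
  tlift_uniq : forall (T : omod) (phi psi : forall U, tobj U -> T U),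
    omorphism phi -> omorphism psi ->
    (forall U x g, phi U (@tpair U x g) = psi U (@tpair U x g)) ->
    forall U t, phi U t = psi U t }.

Arguments tpair [F G] t [U] x g : rename.
Arguments tlift [F G] t [T] b [U] _ : rename.

(* Multiplication O(q) -> O(r) by a homogeneous element of degree r - q. *)
Lemma reg_hmul q r (a : S) (ha : sym_homog (r - q) a) U (g : tws q U) :
  is_regular r U (fun x => emb a * g x).
Proof.
case: g => g [g0 g1] /=; split=> [x /g0 ->|x /g1]; first by rewrite mulr0.
move=> [V [b [f [e [Vx VU hb hf h]]]]]; exists V, (a * b), f, e; split=> //.
  by rewrite -[r](subrK q) -addrA; apply: sym_homogM.
by move=> y /h[yf ->]; rewrite embM mulrA.
Qed.
Definition hmul q r (a : S) (ha : sym_homog (r - q) a) U (g : twisting q U) :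
  twisting r U := Tws (reg_hmul ha g).

(* Gamma_*: the sum of the global sections of the F(q) = F (x) O(q). *)
Section GammaStar.
Variable tw : forall (F : omod) (q : int), tensor F (twisting q).

Lemma gamma_bil F q r a (ha : sym_homog (r - q) a) :
  obilinear (fun U x g => tpair (tw F r) x (hmul ha g)).
Proof.
have [b1 b2 b3 b4 b5] := tpairP (tw F r); split=> U.
- by move=> *; exact: b1.
- move=> x g g'; rewrite -b2; congr tpair; apply: tws_ext => y _ /=.
  exact: mulrDr.
- by move=> *; exact: b3.
- move=> c x g; rewrite -b4; congr tpair; apply: tws_ext => y _ /=.
  exact: mulrCA.
- move=> V VU x g; rewrite b5; congr tpair; apply: tws_ext => y Vy /=.
  by rewrite !asboolT.
Qed.

Definition gamma_act F q r a (ha : sym_homog (r - q) a) :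
    forall U, tw F q U -> tw F r U :=
  tlift (tw F q) (fun U x g => tpair (tw F r) x (hmul ha g)).

Lemma gamma_actP F q r a (ha : sym_homog (r - q) a) : omorphism (@gamma_act F q r a ha).
Proof. exact/tliftP/gamma_bil. Qed.

Lemma gamma_act_pair F q r a (ha : sym_homog (r - q) a) U x g :
  gamma_act ha (tpair (tw F q) (U := U) x g) = tpair (tw F r) x (hmul ha g).
Proof. exact: (@tlift_pair _ _ (tw F q) _ _ (gamma_bil F ha) U x g). Qed.

Lemma omorphismD (F G : omod) (phi psi : forall U, F U -> G U) :
  omorphism phi -> omorphism psi -> omorphism (fun U x => phi U x + psi U x).
Proof.
move=> [a1 a2 a3] [b1 b2 b3]; split.
- by move=> V VU x y; rewrite a1 // b1 // addrACA.
- by move=> V VU a x; rewrite a2 // b2 // scalerDr.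
- by move=> V W WV VU x; rewrite a3 // b3 // oresD.
Qed.

Lemma omorphism_id (F : omod) : omorphism (fun U (x : F U) => x).
Proof. by split. Qed.

Lemma omorphism_comp (F G H : omod) (phi : forall U, F U -> G U) (psi : forall U, G U -> H U) :
  omorphism phi -> omorphism psi -> omorphism (fun U x => psi U (phi U x)).
Proof.
move=> [a1 a2 a3] [b1 b2 b3]; split.
- by move=> V VU x y; rewrite a1 // b1.
- by move=> V VU a x; rewrite a2 // b2.
- by move=> V W WV VU x; rewrite a3 // b3.
Qed.

Lemma omorphism_0 (F G : omod) : omorphism (fun U (x : F U) => 0 : G U).
Proof.
by split=> *; rewrite ?addr0 ?scaler0 ?ores0.
Qed.

Definition gamma_gmod (F : omod) : gmod (@sym_homog k n).
Proof.
apply: (@GMod _ _ (fun q => tw F q openT) (fun q r a ha => @gamma_act F q r a ha openT)).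
- by move=> q r a ha x y; have [+ _ _] := @gamma_actP F q r a ha; apply.
- move=> q r a b ha hb hab; apply: (tlift_uniq (gamma_actP F hab)
                     (omorphismD (gamma_actP F ha) (gamma_actP F hb))).
  move=> U x g; rewrite !gamma_act_pair.
  have [_ <- _ _ _] := tpairP (tw F r); congr tpair; apply: tws_ext => y _ /=.
  by rewrite embD mulrDl.
- move=> q h1; apply: (tlift_uniq (gamma_actP F h1) (@omorphism_id (tw F q))).
  move=> U x g; rewrite gamma_act_pair; congr tpair; apply: tws_ext => y _ /=.
  by rewrite emb1 mul1r.
- move=> q r s a b hb ha hab; apply: (tlift_uniq (gamma_actP F hab)
                     (omorphism_comp (gamma_actP F hb) (gamma_actP F ha))).
  move=> U x g; rewrite !gamma_act_pair; congr tpair; apply: tws_ext => y _ /=.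
  by rewrite embM mulrA.
Defined.

Lemma gamma_map_bil (F G : omod) (phi : forall U, F U -> G U) q : omorphism phi ->
  obilinear (fun U x g => tpair (tw G q) (phi U x) g).
Proof.
have [b1 b2 b3 b4 b5] := tpairP (tw G q) => -[p1 p2 p3]; split=> U.
- by move=> x x' g; rewrite p1 // b1.
- by move=> *; exact: b2.
- by move=> a x g; rewrite p2 // b3.
- by move=> *; exact: b4.
- by move=> V VU x g; rewrite b5 p3.
Qed.

Definition gamma_map (F G : omod) (phi : forall U, F U -> G U) q :
    forall U, tw F q U -> tw G q U :=
  tlift (tw F q) (fun U x g => tpair (tw G q) (phi U x) g).

Lemma gamma_mapP (F G : omod) (phi : forall U, F U -> G U) q :
  omorphism phi -> omorphism (gamma_map phi (q := q)).
Proof. by move=> h; exact/tliftP/gamma_map_bil. Qed.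

Lemma gamma_map_pair (F G : omod) (phi : forall U, F U -> G U) q U x g :
  omorphism phi ->
  gamma_map phi (tpair (tw F q) (U := U) x g) = tpair (tw G q) (phi U x) g.
Proof. by move=> h; exact: (@tlift_pair _ _ (tw F q) _ _ (gamma_map_bil q h) U x g). Qed.

Definition Gamma_star (I : ocomplex) : gcomplex (@sym_homog k n).
Proof.
apply: (@GComplex _ _ (fun p => gamma_gmod (I p))
  (fun p p' q h => @gamma_map (I p) (I p') (odiff I h) q openT)).
- by move=> p p' q h x y; have [+ _ _] := @gamma_mapP _ _ _ q (odiffP I h); apply.
- move=> p p' h q r a ha.
  apply: (tlift_uniq (omorphism_comp (gamma_actP _ ha) (gamma_mapP _ (odiffP I h)))
                     (omorphism_comp (gamma_mapP _ (odiffP I h)) (gamma_actP _ ha))).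
  move=> U x g; rewrite gamma_act_pair !gamma_map_pair; try exact: odiffP.
  by rewrite gamma_act_pair.
- move=> p p' p'' q h h'.
  apply: (tlift_uniq (omorphism_comp (gamma_mapP _ (odiffP I h)) (gamma_mapP _ (odiffP I h')))
                     (omorphism_0 _ _)).
  move=> U x g; rewrite !gamma_map_pair; try exact: odiffP.
  rewrite odiffK; have [b1 _ _ _ _] := tpairP (tw (I p'') q).
  by apply: (addrI (tpair (tw (I p'') q) 0 g)); rewrite -b1 !addr0.
Defined.

End GammaStar.
End Proj.

(* Dual bases of W = V^* and V. *)
Definition dual_bases (k : fieldType) (V : vectType k) (m : nat)
    (v : m.-tuple 'Hom(V, k^o)) (v' : m.-tuple V) : Prop :=
  [/\ basis_of fullv v, basis_of fullv v' &
      forall i j, (tnth v i) (tnth v' j) = (i == j)%:R].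

(* Main.v *)
From HB Require Import structures.
From mathcomp Require Import all_boot all_order all_algebra.
From mathcomp Require Import mpoly boolp zify.
From mathcomp Require Import classical_sets cardinality.
Require Import Defs.

(* The row of the double complex at p is the Koszul complex of Gamma_*(I^p),
   with finitely many terms in each degree, so it is enough that every row is
   exact, and then a cycle of the total complex is a boundary by increasing
   induction on the least p in which it does not vanish. Write J for I^p. A
   global section of J(q) is the same thing, by contraction, as a morphism
   O(-q) -> J, so the row is the complex of morphisms to J from the Koszul
   complex of sheaves of sums of O(-q). The latter is exact, split by a
   contraction and the inverse of a linear form wherever this form does not
   vanish; hence its sheaves of cycles are quasi-coherent and morphisms to the
   injective J stay exact on it. *)

Set Implicit Arguments.
Unset Strict Implicit.
Unset Printing Implicit Defensive.
Import Order.TTheory GRing.Theory Num.Theory.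
Local Open Scope classical_set_scope.
Local Open Scope ring_scope.

(** [J] is injective among quasi-coherent sheaves only, so a morphism extends from the cycles to a
    whole Koszul term only once the sheaf of cycles is known to be quasi-coherent. Its presentation
    comes from the complex itself: exactness makes the cycles a cokernel of a map between sums of
    twists, and these sums are free where a linear form is invertible. The homotopy is the
    antiderivation rule. The Koszul differential is multiplication by the sum of the [v'_a (x) v_a];
    its anticommutator with contraction by [v_b] is the sum of the [v_b(v'_a) v_a], that is [v_b],
    because the bases are dual. The tensor product [J(q)] is known through its universal property
    alone, which does not tell what a section is. Where a linear form [L] is invertible, O(q) is
    generated by [L^q], so every section there is a pure tensor, and all identities about
    contractions are checked on such opens. The Koszul terms are indexed by all subsets at once;
    exterior degrees matter again only in the total complex, where lifts have to be cut down to the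
    right cardinality. *)

Local Notation "V `<=o` U" := (subset (oset V) (oset U)) (at level 70).

(** * Open sets and restriction of sections *)

Section Opens.
Variables (k : fieldType) (n : nat).
Implicit Types U V W D : opens k n.

Lemma openIl U V : openI U V `<=o` U. Proof. by move=> x []. Qed.
Lemma openIr U V : openI U V `<=o` V. Proof. by move=> x []. Qed.
Lemma openIS U V D : V `<=o` U -> openI V D `<=o` openI U D.
Proof. by move=> VU x [/VU]. Qed.
Lemma sub_openI U V W : W `<=o` U -> W `<=o` V -> W `<=o` openI U V.
Proof. by move=> WU WV x Wx; split; [exact: WU|exact: WV]. Qed.
Lemma sub_openT U : U `<=o` openT k n. Proof. by []. Qed.

Lemma OresD U V (VU : V `<=o` U) (a b : OP U) : Ores VU (a + b) = Ores VU a + Ores VU b.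
Proof. by apply: tws_ext => x Vx /=; rewrite !asboolT. Qed.
Lemma OresM U V (VU : V `<=o` U) (a b : OP U) : Ores VU (a * b) = Ores VU a * Ores VU b.
Proof. by apply: tws_ext => x Vx /=; rewrite !asboolT. Qed.
Lemma Ores1 U V (VU : V `<=o` U) : Ores VU 1 = 1.
Proof. by apply: tws_ext => x Vx /=; rewrite !asboolT //; apply: VU. Qed.
Lemma Ores_comp U V W (VU : V `<=o` U) (WV : W `<=o` V) (WU : W `<=o` U) (a : OP U) :
  Ores WV (Ores VU a) = Ores WU a.
Proof. by apply: tws_ext => x Vx /=; rewrite !asboolT //; apply: WV. Qed.

(** The cover is the family of all opens on which [x] and [y] agree, so none has to be chosen. *)
Lemma osep_locally (F : omod k n) U (x y : F U) :
  (forall z, U z -> exists V (VU : V `<=o` U), V z /\ ores VU x = ores VU y) -> x = y.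
Proof.
move=> h; pose I := {V : opens k n | exists VU : V `<=o` U, ores VU x = ores VU y}.
pose C (i : I) := sval i.
have CU (i : I) : C i `<=o` U by case: i => V [].
apply: (@osep _ _ F U I C CU _ x y) => [z /h [V [VU [Vz e]]]|[V hV]].
  by exists (exist _ V (ex_intro _ VU e)).
by have [VU e] := hV; rewrite (ores_irr _ VU) e; apply: ores_irr.
Qed.

Lemma ores_sum (F : omod k n) U V (VU : V `<=o` U) (X : finType) (P : pred X) (f : X -> F U) :
  ores VU (\sum_(i | P i) f i) = \sum_(i | P i) ores VU (f i).
Proof. by elim/big_rec2: _ => [|i y x _ <-]; [exact: ores0|exact: oresD]. Qed.

End Opens.

(** * Direct image of the restriction of a sheaf to an open set *)

Section Pushforward.
Variables (k : fieldType) (n : nat) (D : opens k n) (F : omod k n).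

Definition push_sec (U : opens k n) : Type := F (openI U D).
HB.instance Definition _ U := GRing.Zmodule.on (push_sec U).

Section PushLmod.
Variable U : opens k n.
Let scale (a : OP U) (x : push_sec U) : push_sec U :=
  Ores (@openIl _ _ U D) a *: (x : F (openI U D)).
Lemma push_scaleA a b x : scale a (scale b x) = scale (a * b) x.
Proof. by rewrite /scale OresM scalerA. Qed.
Lemma push_scale1 : left_id 1 scale.
Proof. by move=> x; rewrite /scale Ores1 scale1r. Qed.
Lemma push_scaleDr : right_distributive scale +%R.
Proof. by move=> a x y; rewrite /scale scalerDr. Qed.
Lemma push_scaleDl x : {morph scale^~ x : a b / a + b}.
Proof. by move=> a b; rewrite /scale OresD scalerDl. Qed.
HB.instance Definition _ := GRing.Zmodule_isLmodule.Build (OP U) (push_sec U)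
  push_scaleA push_scale1 push_scaleDr push_scaleDl.
End PushLmod.

Definition push_res U V (VU : V `<=o` U) (x : push_sec U) : push_sec V :=
  ores (openIS (D := D) VU) (x : F (openI U D)).

(* The direct image of the restriction of F to D. The universal property of a
   tensor product is about morphisms of sheaves on the whole space; morphisms to
   direct images make it usable over D. *)
Definition push : omod k n.
Proof.
apply: (@OMod k n (fun U => push_sec U) (fun U V VU => @push_res U V VU)).
- by move=> U V VU x y; exact: oresD.
- move=> U V VU a x.
  rewrite -[RHS]/(Ores (@openIl _ _ V D) (Ores VU a) *: push_res VU x : F _).
  rewrite /push_res oresZ.
  have h : openI V D `<=o` U by move=> y [/VU].
  by rewrite (Ores_comp _ _ h) (Ores_comp _ _ h).
- by move=> U UU x; rewrite /push_res (ores_irr _ (fun y => id)) ores_id.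
- by move=> U V W VU WV WU x; exact: ores_comp.
- move=> U I C CU cov x y h.
  apply: (@osep _ _ F (openI U D) I _ (fun i => openIS (D := D) (CU i)) _ x y)
    => [z [/cov [i iz] Dz]|i].
    by exists i.
  exact: h.
- move=> U I C CU cov x h.
  have cov' z : openI U D z -> exists i, openI (C i) D z.
    by move=> [/cov [i iz] Dz]; exists i.
  apply: (@oglue _ _ F (openI U D) I _ (fun i => openIS (D := D) (CU i)) cov') => i j W Wi Wj.
  have WWD : W `<=o` openI W D by move=> z Wz; split=> //; have [] := Wi z Wz.
  have Wi' : W `<=o` C i by move=> z /Wi [].
  have Wj' : W `<=o` C j by move=> z /Wj [].
  have e : ores (openIS Wi') (x i : F _) = ores (openIS Wj') (x j : F _).
    exact: (h i j W Wi' Wj').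
  by rewrite -(ores_comp (openIS Wi') WWD) e ores_comp.
Defined.
End Pushforward.

(** * Powers of a linear form as generators of the twisting sheaves *)

Section Powers.
Variables (k : fieldType) (n : nat).
Implicit Types U V W : opens k n.

Lemma twsM_subproof d e r (h : d + e = r) U (g : tws d U) (c : tws e U) :
  is_regular r U (fun x => g x * c x).
Proof. by rewrite -h; exact: regM. Qed.
(** The target degree enters through an equation, so that for [q + d = 0] a product is an element of
    [OP U] without transport. *)
Definition twsM d e r (h : d + e = r) U (g : tws d U) (c : tws e U) : tws r U :=
  Tws (twsM_subproof h g c).

Lemma tws_sumE d U (X : finType) (P : pred X) (g : X -> tws d U) x :
  (\sum_(i | P i) g i) x = \sum_(i | P i) g i x.
Proof. by elim/big_rec2: _ => // i y c _ <-. Qed.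

Variables (L : {mpoly k[n]}) (hL : L \is 1.-homog).

Lemma basic_open_subproof : zariski_open (fun x : proj_pt k n => ~ x L).
Proof.
exists [set L]; split=> [_ ->|]; first by exists 1%N.
by apply/seteqP; split=> x /=; [move=> xL; exists L|move=> [_ ->]].
Qed.
Definition basic_open := Opens basic_open_subproof.

Lemma tpow_subproof q U : U `<=o` basic_open ->
  is_regular q U (fun x => if `[< U x >] then emb L ^ q else 0).
Proof.
move=> UL; split=> [x nU|x Ux]; first by case: asboolP.
have hX (m : nat) : sym_homog m (L ^+ m).
  by apply/sym_homogP; have := dhomogMn m hL; rewrite mul1n.
have eX (m : nat) : emb (L ^+ m) = emb L ^+ m.
  by elim: m => [|m IH]; rewrite ?expr0 ?emb1 // !exprS embM IH.
have nX (y : proj_pt k n) (m : nat) : U y -> ~ y (L ^+ m).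
  move=> /UL yL; elim: m => [|m IH]; first by rewrite expr0; exact: pideal1.
  by rewrite exprS => /pideal_prime [/yL|/IH].
case: q => m.
  exists U, (L ^+ m), 1, 0; split=> //; first by rewrite addr0.
    by rewrite -(subrr 0); exact: sym_homog1.
  move=> y Uy; rewrite asboolT // emb1 divr1 eX; split=> //; exact: pideal1.
exists U, 1, (L ^+ m.+1), m.+1; split=> //.
  by rewrite NegzE addNr -(subrr 0); exact: sym_homog1.
move=> y Uy; rewrite asboolT // emb1 div1r eX; split=> //; exact: nX.
Qed.
Definition tpow q U (UL : U `<=o` basic_open) : tws q U := Tws (tpow_subproof q UL).

Lemma tpowE q U (UL : U `<=o` basic_open) x : U x -> tpow q UL x = emb L ^ q.
Proof. by move=> Ux; rewrite /= asboolT. Qed.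

Lemma emb_expD q d U x : U `<=o` basic_open -> U x ->
  emb L ^ (q + d) = emb L ^ q * emb L ^ d.
Proof. by move=> UL /UL xL; rewrite expfzDr // (emb_neq0 xL). Qed.

Lemma tpow_res q U V (VU : V `<=o` U) (UL : U `<=o` basic_open) (VL : V `<=o` basic_open) :
  tws_res VU (tpow q UL) = tpow q VL.
Proof. by apply: tws_ext => x Vx /=; rewrite !asboolT //; exact: VU. Qed.
End Powers.

Lemma eq_scalel k n (F : omod k n) (U : opens k n) (a b : OP U) (x : F U) :
  a = b -> a *: x = b *: x.
Proof. by move->. Qed.

(** * Contraction of sections of F(q) with sections of O(-q) *)

Section Pairing.
Variables (k : fieldType) (n : nat) (F : omod k n) (q d : int) (qd : q + d = 0).
Variable T : tensor F (twisting k n q).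
Implicit Types U V W : opens k n.

Section Fixed.
Variables (U : opens k n) (c : tws d U).

Definition pair_res V (x : F V) (g : twisting k n q V) : F (openI V U) :=
  (twsM qd (tws_res (@openIl _ _ V U) g) (tws_res (@openIr _ _ V U) c) : OP (openI V U))
    *: ores (@openIl _ _ V U) x.

Lemma pair_resDl V x x' g : pair_res (V := V) (x + x') g = pair_res x g + pair_res x' g.
Proof. by rewrite /pair_res oresD scalerDr. Qed.
Lemma pair_resDr V x g g' : pair_res (V := V) x (g + g') = pair_res x g + pair_res x g'.
Proof.
rewrite /pair_res -scalerDl; apply: eq_scalel.
by apply: tws_ext => y [Vy Uy] /=; rewrite !asboolT // mulrDl.
Qed.
Lemma pair_resZl V a x g :
  pair_res (V := V) (a *: x) g = Ores (@openIl _ _ V U) a *: pair_res x g.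
Proof.
rewrite /pair_res oresZ !scalerA; apply: eq_scalel.
by apply: tws_ext => y [Vy Uy] /=; rewrite !asboolT // mulrC.
Qed.
Lemma pair_resZr V (a : OP V) x g :
  pair_res (V := V) x (a *: g) = Ores (@openIl _ _ V U) a *: pair_res x g.
Proof.
rewrite /pair_res !scalerA; apply: eq_scalel.
by apply: tws_ext => y [Vy Uy] /=; rewrite !asboolT // mulrA.
Qed.
Lemma pair_res_res V W (WV : W `<=o` V) x g :
  ores (openIS WV) (pair_res x g) = pair_res (ores WV x) (ores WV g).
Proof.
have h : openI W U `<=o` V by move=> y [/WV].
rewrite /pair_res oresZ (ores_comp _ _ h) (ores_comp _ _ h); apply: eq_scalel.
apply: tws_ext => y [Wy Uy] /=; rewrite !asboolT //.
by split=> //; exact: WV.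
Qed.

Definition pair_bil V (x : F V) (g : twisting k n q V) : push U F V := pair_res x g.
Lemma pair_bilP : obilinear pair_bil.
Proof.
split=> V; [exact: pair_resDl|exact: pair_resDr|exact: pair_resZl|exact: pair_resZr|].
exact: pair_res_res.
Qed.

Definition pair_push : forall V, T V -> push U F V := tlift (t0 := T) (T := push U F) pair_bil.
Lemma pair_pushP : omorphism pair_push. Proof. exact/tliftP/pair_bilP. Qed.
Lemma pair_push_pair V x g : pair_push (tpair T (U := V) x g) = pair_bil x g.
Proof. exact: (@tlift_pair _ _ _ _ T _ _ pair_bilP V x g). Qed.

Definition contract (s : T (openT k n)) : F U :=
  ores (sub_openI (@sub_openT _ _ U) (fun x Ux => Ux)) (pair_push s : F (openI (openT k n) U)).

(** The universal property gives values on pure tensors alone; restricting to an open where [s]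
    becomes pure is what makes [contract] computable. *)
Lemma contractE V (VU : V `<=o` U) (s : T (openT k n)) (x : F V) (g : tws q V) :
  ores (@sub_openT _ _ V) s = tpair T x g ->
  ores VU (contract s) = (twsM qd g (tws_res VU c) : OP V) *: x.
Proof.
move=> e.
have VVU : V `<=o` openI V U by exact: sub_openI.
have VTU : V `<=o` openI (openT k n) U by exact: sub_openI.
rewrite /contract (ores_comp _ _ VTU).
rewrite -(ores_comp (openIS (D := U) (@sub_openT _ _ V)) VVU).
have [_ _ /(_ _ _ (@sub_openT _ _ V) (fun _ h => h) s) h] := pair_pushP.
rewrite -[X in ores VVU X]/(ores (o := push U F) (@sub_openT _ _ V) (pair_push s)) -h e.
rewrite pair_push_pair /pair_bil /pair_res oresZ (ores_comp _ _ (fun _ h => h)) ores_id.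
apply: eq_scalel; apply: tws_ext => y Vy /=; rewrite !asboolT //.
by split=> //; exact: VU.
Qed.
End Fixed.

(** On [D], where [L] is invertible, [x] has to be the contraction of [s] with [L^d], [d = -q].
    Restriction to [D] and the map from [s] to [x (x) L^q] are two morphisms to the direct image of
    [T] from [D]; they agree on pure tensors, hence everywhere. *)
Lemma pure_section (L : {mpoly k[n]}) (hL : L \is 1.-homog) V
    (VL : V `<=o` basic_open hL) (s : T V) :
  exists x : F V, s = tpair T x (tpow q VL).
Proof.
pose D := basic_open hL.
pose phi W (s : T W) : push D T W := ores (@openIl _ _ W D) s.
pose c : tws d D := tpow d (fun _ h => h).
pose psi W (s : T W) : push D T W :=
  tpair T (U := openI W D) (pair_push c s) (tpow q (@openIr _ _ W D)).
have [b1 b2 b3 b4 b5] := tpairP T.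
have [p1 p2 p3] := pair_pushP c.
have hphi : omorphism phi.
  split.
  - by move=> W _ x y; exact (@oresD _ _ T _ _ (@openIl _ _ W D) x y).
  - by move=> W _ a x; exact (@oresZ _ _ T _ _ (@openIl _ _ W D) a x).
  - move=> W W' W'W _ x.
    rewrite -[RHS]/(ores (openIS (D := D) W'W) (ores (@openIl _ _ W D) x)).
    have h : openI W' D `<=o` W by move=> y [/W'W].
    by rewrite /phi (ores_comp _ _ h) (ores_comp _ _ h).
have hpsi : omorphism psi.
  split.
  - by move=> W _ x y; rewrite /psi p1 // b1.
  - by move=> W _ a x; rewrite /psi p2 // b3.
  - move=> W W' W'W _ x.
    rewrite -[RHS]/(ores (openIS (D := D) W'W) (psi W x : T (openI W D))).
    rewrite /psi p3 // b5; congr (tpair T).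
    by rewrite -[RHS]/(tws_res _ _) (tpow_res _ _ _ (@openIr _ _ W' D)).
have e : phi V s = psi V s.
  apply: (tlift_uniq hphi hpsi) => W x g.
  rewrite /phi /psi b5 pair_push_pair /pair_bil /pair_res b3 -b4; congr (tpair T).
  apply: tws_ext => y [Wy Dy] /=; rewrite !asboolT //.
  rewrite mulrAC -mulrA -(emb_expD _ _ (fun _ h => h) Dy) qd expr0z mulr1 //.
have VVD : V `<=o` openI V D by exact: sub_openI.
exists (ores VVD (pair_push c s : F (openI V D))).
rewrite -[LHS](ores_id (fun _ h => h)) -(ores_comp (@openIl _ _ V D) VVD).
rewrite -[ores (@openIl _ _ V D) s]/(phi V s) e /psi b5; congr (tpair T).
by rewrite -[LHS]/(tws_res _ _) (tpow_res _ _ _ VL).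
Qed.

End Pairing.

(** * Global sections of F(q) as morphisms from O(-q) to F *)

Section Contraction.
Variables (k : fieldType) (n : nat).
Variables (m : nat) (L : 'I_m -> {mpoly k[n]}) (hL : forall a, L a \is 1.-homog).
Hypothesis cov : forall y : proj_pt k n, exists a, ~ y (L a).
Implicit Types U V W : opens k n.

Section OneSheaf.
Variables (F : omod k n) (q d : int) (qd : q + d = 0).
Variable T : tensor F (twisting k n q).

Lemma locally_pure (s : T (openT k n)) U z : U z ->
  exists V (VU : V `<=o` U) a (VL : V `<=o` basic_open (hL a)) (x : F V),
    V z /\ ores (@sub_openT _ _ V) s = tpair T x (tpow q VL).
Proof.
move=> Uz; have [a za] := cov z.
pose V := openI U (basic_open (hL a)).
have VL : V `<=o` basic_open (hL a) by exact: openIr.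
have [x e] := pure_section qd VL (ores (@sub_openT _ _ V) s).
by exists V, (@openIl _ _ _ _), a, VL, x.
Qed.

(** One pure expression of [s] serves every [c] at once, so linearity in [c] can be read off from
    the formula. *)
Lemma contract_local (s : T (openT k n)) U z : U z ->
  exists V (VU : V `<=o` U) (g : tws q V) (x : F V), V z /\
    forall c : tws d U, ores VU (contract qd c s) = (twsM qd g (tws_res VU c) : OP V) *: x.
Proof.
move=> /(locally_pure s) [V [VU [a [VL [x [Vz e]]]]]].
by exists V, VU, (tpow q VL), x; split=> // c; exact: contractE.
Qed.

Lemma contractD U (c : tws d U) (s s' : T (openT k n)) :
  contract qd c (s + s') = contract qd c s + contract qd c s'.
Proof.
rewrite /contract; have [-> // _ _] := pair_pushP qd T c.
exact: (@oresD _ _ F).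
Qed.

Lemma contract0 U (c : tws d U) : contract qd c (0 : T (openT k n)) = 0.
Proof. by apply: (addrI (contract qd c (0 : T (openT k n)))); rewrite -contractD !addr0. Qed.

Lemma contract_sum U (c : tws d U) (Y : finType) (s : Y -> T (openT k n)) :
  contract qd c (\sum_i s i) = \sum_i contract qd c (s i).
Proof.
by elim/big_rec2: _ => [|i y x _ <-]; [exact: contract0|exact: contractD].
Qed.

Lemma contractDr U (c c' : tws d U) (s : T (openT k n)) :
  contract qd (c + c') s = contract qd c s + contract qd c' s.
Proof.
apply: osep_locally => z /(contract_local s) [V [VU [g [x [Vz e]]]]].
exists V, VU; split=> //; rewrite oresD !e -scalerDl; apply: eq_scalel.
by apply: tws_ext => y Vy /=; rewrite !asboolT // mulrDr.
Qed.

Lemma contractZ U (a : OP U) (c : tws d U) (s : T (openT k n)) :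
  contract qd (a *: c) s = a *: contract qd c s.
Proof.
apply: osep_locally => z /(contract_local s) [V [VU [g [x [Vz e]]]]].
exists V, VU; split=> //; rewrite oresZ !e scalerA; apply: eq_scalel.
by apply: tws_ext => y Vy /=; rewrite !asboolT // mulrCA.
Qed.

Lemma contract_res U W (WU : W `<=o` U) (c : tws d U) (s : T (openT k n)) :
  contract qd (tws_res WU c) s = ores WU (contract qd c s).
Proof.
apply: osep_locally => z /(locally_pure s) [V [VW [a [VL [x [Vz e]]]]]].
have VU : V `<=o` U by move=> y /VW /WU.
exists V, VW; split=> //; rewrite (ores_comp _ _ VU) !(contractE _ _ _ e).
by apply: eq_scalel; apply: tws_ext => y Vy /=; rewrite !asboolT //; exact: VW.
Qed.

Lemma contract_hom (s : T (openT k n)) :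
  omorphism (fun U (c : twisting k n d U) => contract qd c s).
Proof.
split=> U; [by move=> _ c c'; exact: contractDr|by move=> _ a c; exact: contractZ|].
by move=> V VU _ c; exact: contract_res.
Qed.

(** Where [s] is [x (x) L^q], contraction with [L^d] gives back [x], since [L^q L^d = 1]. *)
Lemma contract_inj (s : T (openT k n)) :
  (forall U (c : tws d U), contract qd c s = 0) -> s = 0.
Proof.
move=> h; apply: osep_locally => z /(locally_pure s) [V [VT [a [VL [x [Vz e]]]]]].
exists V, VT; split=> //; rewrite (ores_irr _ (@sub_openT _ _ V)) ores0 e.
have := contractE (F := F) qd (tpow d VL) (fun _ h => h) e.
rewrite h ores0; set b := twsM _ _ _.
have -> : b = 1 :> OP V.
  apply: tws_ext => y Vy /=; rewrite !asboolT //.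
  by rewrite -(emb_expD _ _ VL Vy) qd expr0z.
rewrite scale1r => <-.
have [b1 _ _ _ _] := tpairP T.
by apply: (addrI (tpair T 0 (tpow q VL))); rewrite -b1 !addr0.
Qed.

(** Where [L a] is invertible the section must be the tensor of [h] at [(L a)^d] with [(L a)^q];
    these local tensors agree on overlaps and glue. *)
Lemma contract_surj (h : forall U, twisting k n d U -> F U) : omorphism h ->
  exists s : T (openT k n), forall U (c : tws d U), contract qd c s = h U c.
Proof.
move=> [h1 h2 h3]; have [b1 b2 b3 b4 b5] := tpairP T.
pose C a := basic_open (hL a).
pose CC a : C a `<=o` C a := fun _ h => h.
pose g a : T (C a) := tpair T (h (C a) (tpow d (CC a))) (tpow q (CC a)).
have cov' x : openT k n x -> exists a, C a x by move=> _; exact: cov.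
have gE a W (Wa : W `<=o` C a) : ores Wa (g a) = tpair T (h W (tpow d Wa)) (tpow q Wa).
  rewrite /g b5 -h3 //; congr (tpair T).
    by congr h; rewrite -[LHS]/(tws_res _ _) (tpow_res _ _ _ Wa).
  by rewrite -[LHS]/(tws_res _ _) (tpow_res _ _ _ Wa).
have dq : d + q = 0 by rewrite addrC.
have [|s hs] := @oglue _ _ T (openT k n) 'I_m C (fun a => @sub_openT _ _ (C a)) cov' g.
  move=> a b W Wa Wb; rewrite !gE.
  (* [u] is the function [(L a / L b)^d]: it comes out of [h] by linearity and crosses the tensor
     sign, where it turns [(L a)^q] into [(L b)^q]. *)
  pose u : OP W := twsM dq (tpow d Wa) (tpow q Wb).
  have -> : tpow d Wa = u *: (tpow d Wb : twisting k n d W).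
    apply: tws_ext => y Wy /=; rewrite !asboolT //.
    by rewrite -mulrA -(emb_expD _ _ Wb Wy) qd expr0z mulr1.
  rewrite h2 // b3 -b4; congr (tpair T).
  apply: tws_ext => y Wy /=; rewrite !asboolT //.
  by rewrite mulrAC -(emb_expD _ _ Wa Wy) dq expr0z mul1r.
exists s => U c; apply: osep_locally => z Uz; have [a za] := cov z.
pose V := openI U (C a); have VU : V `<=o` U := @openIl _ _ _ _.
have VC : V `<=o` C a := @openIr _ _ _ _.
exists V, VU; split=> //.
have e : ores (@sub_openT _ _ V) s = tpair T (h V (tpow d VC)) (tpow q VC).
  by rewrite -gE -hs (ores_comp _ _ (@sub_openT _ _ V)).
rewrite (contractE _ _ _ e) -h2 // -h3 //; congr h.
apply: tws_ext => y [Uy Cy] /=; rewrite !asboolT //.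
by rewrite mulrAC -(emb_expD _ _ VC (conj Uy Cy)) qd expr0z mul1r.
Qed.
End OneSheaf.

Section Action.
Variable tw : forall (F : omod k n) (q : int), tensor F (twisting k n q).

(** The action on sections is transposed to multiplication on the twisting sheaves; this is why the
    differential of a row is the transpose of the differential of sheaves. *)
Lemma contract_act (F : omod k n) q r a (ha : sym_homog (r - q) a) d e
    (qd : q + d = 0) (re : r + e = 0) (ha' : sym_homog (d - e) a)
    U (c : tws e U) (s : tw F q (openT k n)) :
  contract re c (gamma_act (tw:=tw) ha s) = contract qd (hmul ha' c) s.
Proof.
apply: osep_locally => z /(locally_pure qd s) [V [VU [i [VL [x [Vz E]]]]]].
exists V, VU; split=> //; rewrite (contractE _ _ _ E).
have E' : ores (@sub_openT _ _ V) (gamma_act (tw:=tw) ha s) =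
    tpair (tw F r) x (hmul ha (tpow q VL)).
  have [_ _ <- //] := gamma_actP tw F ha.
  by rewrite E; exact: gamma_act_pair.
rewrite (contractE _ _ _ E'); apply: eq_scalel.
by apply: tws_ext => y Vy /=; rewrite !asboolT // mulrCA mulrA.
Qed.
End Action.
End Contraction.

(** * Factorization through an epimorphism of sheaves, and kernels *)

Section Sheaves.
Variables (k : fieldType) (n : nat).
Implicit Types U V W : opens k n.

Section HomTheory.
Variables (F G : omod k n) (phi : forall U, F U -> G U) (hphi : omorphism phi).
Arguments phi : clear implicits.
Lemma omorD U x y : phi U (x + y) = phi U x + phi U y.
Proof. by have [-> // _ _] := hphi. Qed.
Lemma omorZ U a x : phi U (a *: x) = a *: phi U x.
Proof. by have [_ -> // _] := hphi. Qed.
Lemma omor_res U V (VU : V `<=o` U) x : phi V (ores VU x) = ores VU (phi U x).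
Proof. by have [_ _ ->] := hphi. Qed.
Lemma omor0 U : phi U 0 = 0.
Proof. by apply: (addrI (phi U 0)); rewrite -omorD !addr0. Qed.
Lemma omorN U x : phi U (- x) = - phi U x.
Proof. by apply/eqP; rewrite -addr_eq0 -omorD addNr omor0. Qed.
Lemma omor_sum U (X : finType) (P : pred X) (f : X -> F U) :
  phi U (\sum_(i | P i) f i) = \sum_(i | P i) phi U (f i).
Proof. by elim/big_rec2: _ => [|i y x _ <-]; [exact: omor0|exact: omorD]. Qed.
End HomTheory.

Section EpiFactor.
Variables (C K J : omod k n) (phi : forall U, C U -> K U) (g : forall U, C U -> J U).
Arguments phi : clear implicits.
Arguments g : clear implicits.
Hypotheses (hphi : omorphism phi) (hg : omorphism g) (ephi : epi_on (openT k n) phi).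
Hypothesis kerg : forall U c, phi U c = 0 -> g U c = 0.

(** The graph of the factorization, described locally. Two lifts of [x] differ by an element of the
    kernel of [phi], which [g] kills; so [y] is unique and local values glue. *)
Let rel U (x : K U) (y : J U) := forall z, U z ->
  exists V (VU : V `<=o` U) (c : C V), [/\ V z, phi V c = ores VU x & g V c = ores VU y].

Let g_eq U c c' : phi U c = phi U c' -> g U c = g U c'.
Proof.
move=> e; apply/eqP; rewrite -subr_eq0 -(omorN hg) -(omorD hg).
by apply/eqP/kerg; rewrite (omorD hphi) (omorN hphi) e subrr.
Qed.

Let rel2 U (x x' : K U) (y y' : J U) z : rel x y -> rel x' y' -> U z ->
  exists V (VU : V `<=o` U) (c c' : C V), [/\ V z,
    phi V c = ores VU x /\ g V c = ores VU y & phi V c' = ores VU x' /\ g V c' = ores VU y'].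
Proof.
move=> r r' Uz; have [V [VU [c [Vz e1 e2]]]] := r z Uz.
have [V' [VU' [c' [Vz' e1' e2']]]] := r' z Uz.
have i1 := @openIl _ _ V V'; have i2 := @openIr _ _ V V'.
have iU : openI V V' `<=o` U by move=> y0 /i1 /VU.
exists (openI V V'), iU, (ores i1 c), (ores i2 c'); split=> //.
  by rewrite (omor_res hphi) (omor_res hg) e1 e2 !(ores_comp _ _ iU).
by rewrite (omor_res hphi) (omor_res hg) e1' e2' !(ores_comp _ _ iU).
Qed.

Let rel_uniq U (x : K U) (y y' : J U) : rel x y -> rel x y' -> y = y'.
Proof.
move=> r r'; apply: osep_locally => z /(rel2 r r').
move=> [V [VU [c [c' [Vz [e1 e2] [e1' e2']]]]]]; exists V, VU; split=> //.
by rewrite -e2 -e2'; apply: g_eq; rewrite e1.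
Qed.

Let rel_ex U (x : K U) : exists y, rel x y.
Proof.
pose I := {V : opens k n & {c : C V | exists VU : V `<=o` U, phi V c = ores VU x}}.
pose D (i : I) := projT1 i.
have DU (i : I) : D i `<=o` U by case: i => V [c []].
pose t (i : I) : C (D i) := sval (projT2 i).
have tE (i : I) : phi _ (t i) = ores (DU i) x.
  rewrite /t; move: (DU i); case: i => V [c [VU e]] /= VU'.
  by rewrite e; exact: ores_irr.
have cov z : U z -> exists i, D i z.
  move=> /(ephi (@sub_openT _ _ U) x) [V [VU [c [Vz e]]]].
  by exists (existT _ V (exist _ c (ex_intro _ VU e))).
have [|y hy] := @oglue _ _ J U I D DU cov (fun i => g (D i) (t i)).
  move=> i j W Wi Wj; rewrite -!(omor_res hg); apply: g_eq.
  have WU : W `<=o` U by move=> z /Wi /DU.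
  by rewrite !(omor_res hphi) !tE !(ores_comp _ _ WU).
by exists y => z /cov [i iz]; exists (D i), (DU i), (t i).
Qed.

Lemma epi_factor : exists g' : forall U, K U -> J U,
  omorphism g' /\ forall U c, g' U (phi U c) = g U c.
Proof.
pose g' U (x : K U) := projT1 (cid (rel_ex x)).
have g'P U x : rel x (@g' U x) by exact: projT2 (cid (rel_ex x)).
exists g'; split; last first.
  move=> U c; apply: rel_uniq (g'P _ _) _ => z Uz.
  by exists U, (fun _ h => h), c; rewrite !ores_id.
split=> U.
- move=> _ x x'; apply: rel_uniq (g'P _ _) _ => z Uz.
  have [V [VU [c [c' [Vz [e1 e2] [e1' e2']]]]]] := rel2 (g'P U x) (g'P U x') Uz.
  exists V, VU, (c + c'); split=> //; first by rewrite (omorD hphi) oresD e1 e1'.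
  by rewrite (omorD hg) oresD e2 e2'.
- move=> _ a x; apply: rel_uniq (g'P _ _) _ => z /(g'P U x) [V [VU [c [Vz e1 e2]]]].
  exists V, VU, (Ores VU a *: c); split=> //; first by rewrite (omorZ hphi) oresZ e1.
  by rewrite (omorZ hg) oresZ e2.
- move=> W WU _ x; apply: rel_uniq (g'P _ _) _ => z Wz.
  have [V [VU [c [Vz e1 e2]]]] := g'P U x z (WU z Wz).
  have i1 := @openIl _ _ V W; have i2 := @openIr _ _ V W.
  have iU : openI V W `<=o` U by move=> y0 /i1 /VU.
  exists (openI V W), i2, (ores i1 c); split=> //.
    by rewrite (omor_res hphi) e1 !(ores_comp _ _ iU).
  by rewrite (omor_res hg) e2 !(ores_comp _ _ iU).
Qed.
End EpiFactor.

Section Kernel.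
Variables (F G : omod k n) (phi : forall U, F U -> G U) (hphi : omorphism phi).
Arguments phi : clear implicits.

Record ker_sec U := KerSec { ker_val :> F U; ker_valP : phi U ker_val = 0 }.

Lemma ker_ext U (x y : ker_sec U) : ker_val x = ker_val y -> x = y.
Proof.
case: x y => [x hx] [y hy] /= e; rewrite -e in hy *; congr KerSec.
exact: Prop_irrelevance.
Qed.

HB.instance Definition _ U := gen_eqMixin (ker_sec U).
HB.instance Definition _ U := gen_choiceMixin (ker_sec U).

Section KerLmod.
Variable U : opens k n.
Let zero : ker_sec U := KerSec (omor0 hphi U).
Lemma ker_add_subproof (x y : ker_sec U) : phi U (ker_val x + ker_val y) = 0.
Proof. by rewrite (omorD hphi) !ker_valP addr0. Qed.
Let add x y := KerSec (ker_add_subproof x y).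
Lemma ker_opp_subproof (x : ker_sec U) : phi U (- ker_val x) = 0.
Proof. by rewrite (omorN hphi) ker_valP oppr0. Qed.
Let opp x := KerSec (ker_opp_subproof x).
Lemma ker_scale_subproof a (x : ker_sec U) : phi U (a *: ker_val x) = 0.
Proof. by rewrite (omorZ hphi) ker_valP scaler0. Qed.
Let scale a x := KerSec (ker_scale_subproof a x).
Lemma ker_addA : associative add.
Proof. by move=> x y z; apply: ker_ext; exact: addrA. Qed.
Lemma ker_addC : commutative add.
Proof. by move=> x y; apply: ker_ext; exact: addrC. Qed.
Lemma ker_add0 : left_id zero add.
Proof. by move=> x; apply: ker_ext; exact: add0r. Qed.
Lemma ker_addN : left_inverse zero opp add.
Proof. by move=> x; apply: ker_ext; exact: addNr. Qed.
HB.instance Definition _ :=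
  GRing.isZmodule.Build (ker_sec U) ker_addA ker_addC ker_add0 ker_addN.
Lemma ker_scaleA a b x : scale a (scale b x) = scale (a * b) x.
Proof. by apply: ker_ext; exact: scalerA. Qed.
Lemma ker_scale1 : left_id 1 scale.
Proof. by move=> x; apply: ker_ext; exact: scale1r. Qed.
Lemma ker_scaleDr : right_distributive scale +%R.
Proof. by move=> a x y; apply: ker_ext; exact: scalerDr. Qed.
Lemma ker_scaleDl x : {morph scale^~ x : a b / a + b}.
Proof. by move=> a b; apply: ker_ext; exact: scalerDl. Qed.
HB.instance Definition _ := GRing.Zmodule_isLmodule.Build (OP U) (ker_sec U)
  ker_scaleA ker_scale1 ker_scaleDr ker_scaleDl.
End KerLmod.

Lemma ker_res_subproof U V (VU : V `<=o` U) (x : ker_sec U) : phi V (ores VU x) = 0.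
Proof. by rewrite (omor_res hphi) ker_valP ores0. Qed.
Definition ker_res U V (VU : V `<=o` U) (x : ker_sec U) : ker_sec V :=
  KerSec (ker_res_subproof VU x).

Definition ker_sheaf : omod k n.
Proof.
apply: (@OMod k n (fun U => ker_sec U) (fun U V VU => @ker_res U V VU)).
- by move=> U V VU x y; apply: ker_ext; exact: oresD.
- by move=> U V VU a x; apply: ker_ext; exact: oresZ.
- by move=> U UU x; apply: ker_ext; exact: ores_id.
- by move=> U V W VU WV WU x; apply: ker_ext; exact: ores_comp.
- move=> U I C CU cov x y h; apply: ker_ext.
  apply: (@osep _ _ F U I C CU cov) => i.
  exact: (congr1 (@ker_val (C i)) (h i)).
- move=> U I C CU cov x h.
  have [|y hy] := @oglue _ _ F U I C CU cov (fun i => x i).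
    by move=> i j W Wi Wj; exact: (congr1 (@ker_val W) (h i j W Wi Wj)).
  have y0 : phi U y = 0.
    apply: (@osep _ _ G U I C CU cov) => i.
    by rewrite -(omor_res hphi) hy ker_valP ores0.
  by exists (KerSec y0) => i; apply: ker_ext; exact: hy.
Defined.

Definition ker_incl U (x : ker_sheaf U) : F U := ker_val x.
Lemma ker_incl_hom : omorphism ker_incl. Proof. by []. Qed.
Lemma ker_incl_mono : mono_on (openT k n) ker_incl.
Proof. by move=> U _ x y; exact: ker_ext. Qed.
End Kernel.
End Sheaves.

Lemma ohom_comp k n (U : opens k n) (F G H : omod k n) (phi : forall V, F V -> G V)
    (psi : forall V, G V -> H V) :
  ohom U phi -> ohom U psi -> ohom U (fun V x => psi V (phi V x)).
Proof.
move=> [a1 a2 a3] [b1 b2 b3]; split.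
- by move=> V VU x y; rewrite a1 // b1.
- by move=> V VU a x; rewrite a2 // b2.
- by move=> V W WV VU x; rewrite a3 // b3.
Qed.

Lemma omorphism_ohom k n (U : opens k n) (F G : omod k n) (phi : forall V, F V -> G V) :
  omorphism phi -> ohom U phi.
Proof. by move=> [a1 a2 a3]; split=> V *; [exact: a1|exact: a2|exact: a3]. Qed.

(** * The Koszul complex of sheaves and its morphisms to an injective *)

Section KoszulSheaf.
Variables (k : fieldType) (n : nat) (X : finType).
Local Notation S := {mpoly k[n]}.
Implicit Types U V W : opens k n.

(** A [copower] although [X] is finite, so that [csum 0] is [free_sheaf X] by definition and can
    serve in presentations. *)
Definition csum e : omod k n := copower (twisting k n e) X.
Definition cval e U (c : csum e U) (A : X) : tws e U := copf (c : copsec (twisting k n e) X U) A.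

Arguments cval : simpl never.

Lemma csum_lf e U (c : X -> tws e U) : @locally_finite k n (twisting k n e) X U c.
Proof. by move=> x Ux; exists U, (fun _ h => h); split=> //; exact: finite_finset. Qed.
Definition csum_mk e U (c : X -> tws e U) : csum e U := Cop (csum_lf c).

Lemma csumP e U (c c' : csum e U) :
  (forall A x, U x -> cval c A x = cval c' A x) -> c = c'.
Proof. by move=> h; apply: cop_ext => A; apply: tws_ext => x; exact: h. Qed.

Lemma cvalD e U (c c' : csum e U) A x : cval (c + c') A x = cval c A x + cval c' A x.
Proof. by []. Qed.
Lemma cvalZ e U (a : OP U) (c : csum e U) A x : cval (a *: c) A x = a x * cval c A x.
Proof. by []. Qed.
Lemma cval0 e U A x : cval (0 : csum e U) A x = 0.
Proof. by []. Qed.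
Lemma cval_res e U V (VU : V `<=o` U) (c : csum e U) A x : V x ->
  cval (ores VU c) A x = cval c A x.
Proof. by move=> Vx; rewrite /cval /= asboolT. Qed.
Lemma cval_mk e U (c : X -> tws e U) A : cval (csum_mk c) A = c A.
Proof. by []. Qed.

Lemma emb_sum (Y : finType) (P : pred Y) (f : Y -> S) :
  emb (\sum_(i | P i) f i) = \sum_(i | P i) emb (f i).
Proof. by elim/big_rec2: _ => [|i y x _ <-]; [exact: emb0|exact: embD]. Qed.

Section Rescale.
Variables (L : S) (hL : L \is 1.-homog).
Local Notation D := (basic_open hL).

(* Multiplication by L^(e' - e), extended by 0 to the open sets on which it
   makes no sense. *)
Definition rescale e e' V (c : csum e V) : csum e' V :=
  csum_mk (fun A => if pselect (V `<=o` D) is left VL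
                    then twsM (subrK e e') (tpow (e' - e) VL) (cval c A) else 0).

Lemma rescaleE e e' V (c : csum e V) A x : V `<=o` D -> V x ->
  cval (rescale e' c) A x = emb L ^ (e' - e) * cval c A x.
Proof.
move=> VL Vx; rewrite cval_mk; case: pselect => // VL'.
by rewrite -[LHS]/(tpow (e' - e) VL' x * cval c A x) tpowE.
Qed.

Lemma rescale_hom e e' : ohom D (@rescale e e').
Proof.
split=> V.
- move=> VL c c'; apply: csumP => A x Vx.
  by rewrite cvalD !rescaleE // cvalD mulrDr.
- move=> VL a c; apply: csumP => A x Vx.
  by rewrite cvalZ !rescaleE // cvalZ mulrCA.
- move=> W WV VL c; apply: csumP => A x Wx.
  have WL : W `<=o` D by move=> y /WV /VL.
  by rewrite cval_res // !rescaleE ?cval_res //; exact: WV.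
Qed.

Lemma rescaleK e e' V (c : csum e V) : V `<=o` D -> rescale e (rescale e' c) = c.
Proof.
move=> VL; apply: csumP => A x Vx; rewrite !rescaleE // mulrA.
by rewrite -(emb_expD _ _ VL Vx) [X in _ ^ X](_ : _ = 0) ?expr0z ?mul1r //; lia.
Qed.
End Rescale.

Variables (Th : X -> X -> S) (hTh : forall A B, Th A B \is 1.-homog).
Hypothesis Th2 : forall A C : X, \sum_B Th A B * Th B C = 0.

Lemma Th_homog e e' (h : e' = e + 1) A B : sym_homog (e' - e) (Th A B).
Proof. by rewrite h addrAC subrr add0r; apply/sym_homogP/hTh. Qed.

Definition kdiff e e' (h : e' = e + 1) U (c : csum e U) : csum e' U :=
  csum_mk (fun A => \sum_B (hmul (@Th_homog e e' h A B) (cval c B) : tws e' U)).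

Lemma kdiffE e e' (h : e' = e + 1) U (c : csum e U) A x :
  cval (kdiff h c) A x = \sum_B emb (Th A B) * cval c B x.
Proof. by rewrite cval_mk tws_sumE. Qed.

Lemma kdiff_hom e e' (h : e' = e + 1) : omorphism (kdiff h).
Proof.
split=> U.
- move=> _ c c'; apply: csumP => A x Ux; rewrite cvalD !kdiffE -big_split.
  by apply: eq_bigr => B _; rewrite cvalD mulrDr.
- move=> _ a c; apply: csumP => A x Ux; rewrite cvalZ !kdiffE mulr_sumr.
  by apply: eq_bigr => B _; rewrite cvalZ mulrCA.
- move=> V VU _ c; apply: csumP => A x Vx; rewrite cval_res // !kdiffE.
  by apply: eq_bigr => B _; rewrite cval_res.
Qed.

Lemma kdiffK e e' e'' (h : e' = e + 1) (h' : e'' = e' + 1) U (c : csum e U) :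
  kdiff h' (kdiff h c) = 0.
Proof.
apply: csumP => A x Ux; rewrite kdiffE cval0.
under eq_bigr => B _ do rewrite kdiffE mulr_sumr.
rewrite exchange_big big1 // => C _ /=.
under eq_bigr => B _ do rewrite mulrA -embM.
by rewrite -mulr_suml -emb_sum Th2 emb0 mul0r.
Qed.

Variables (m : nat) (L : 'I_m -> S) (hL : forall a, L a \is 1.-homog).
Hypothesis cov : forall y : proj_pt k n, exists a, ~ y (L a).
Variable H : 'I_m -> X -> X -> k.
Hypothesis homotopy : forall a (A C : X),
  \sum_B ((H a A B)%:MP * Th B C + Th A B * (H a B C)%:MP) = (A == C)%:R * L a.

Lemma kdiff_split e e' e'' (h : e' = e + 1) (h' : e'' = e' + 1) a V (c : csum e' V) :
  V `<=o` basic_open (hL a) -> kdiff h' c = 0 ->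
  exists c' : csum e V, kdiff h c' = c.
Proof.
move=> VL dc0.
have d0 A x : \sum_B emb (Th A B) * cval c B x = 0.
  by rewrite -(kdiffE h') dc0.
pose Hc A : tws e' V := \sum_B (hmul (@sym_homogC k n e' (H a A B)) (cval c B) : tws e' V).
have e1 : -1 + e' = e by lia.
exists (csum_mk (fun A => twsM e1 (tpow (-1) VL) (Hc A))).
apply: csumP => A x Vx; rewrite kdiffE.
have HcE B : Hc B x = \sum_C emb (H a B C)%:MP * cval c C x by rewrite tws_sumE.
set l := emb (L a) ^ (-1).
transitivity (\sum_C l * emb ((A == C)%:R * L a) * cval c C x).
  transitivity (\sum_B emb (Th A B) * (l * Hc B x)).
    apply: eq_bigr => B _; congr (_ * _); rewrite cval_mk.
    by rewrite -[LHS]/(tpow (-1) VL x * Hc B x) tpowE.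
  (* The added sum is zero because [c] is a cycle; it completes the anticommutator. *)
  transitivity (\sum_B l * (emb (Th A B) * Hc B x) +
      l * \sum_B emb (H a A B)%:MP * \sum_C emb (Th B C) * cval c C x).
    under [X in _ * X]eq_bigr => B _ do rewrite d0 mulr0.
    by rewrite big1_eq mulr0 addr0; apply: eq_bigr => B _; rewrite mulrCA.
  rewrite -mulr_sumr -mulrDr -big_split /=.
  under [RHS]eq_bigr => C _ do rewrite -mulrA.
  rewrite -mulr_sumr; congr (_ * _).
  under [RHS]eq_bigr => C _ do rewrite -homotopy emb_sum mulr_suml.
  rewrite [RHS]exchange_big; apply: eq_bigr => B _ /=.
  rewrite HcE !mulr_sumr -big_split; apply: eq_bigr => C _ /=.
  by rewrite embD !embM mulrDl !mulrA addrC.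
rewrite (bigD1 A) //= eqxx big1 ?addr0 => [|C /negPf nC]; last first.
  by rewrite eq_sym nC mul0r emb0 mulr0 mul0r.
rewrite mul1r -[X in _ * X * _]expr1z /l -(emb_expD _ _ VL Vx).
by rewrite addNr expr0z mul1r.
Qed.

Lemma kdiff_exact e e' e'' (h : e' = e + 1) (h' : e'' = e' + 1) U (c : csum e' U) :
  kdiff h' c = 0 -> forall z, U z ->
  exists V (VU : V `<=o` U) (c' : csum e V), V z /\ kdiff h c' = ores VU c.
Proof.
move=> dc0 z Uz; have [a za] := cov z.
pose V := openI U (basic_open (hL a)).
have VU : V `<=o` U by exact: openIl.
have VL : V `<=o` basic_open (hL a) by exact: openIr.
have dV : kdiff h' (ores VU c) = 0.
  by rewrite (omor_res (kdiff_hom h')) dc0 ores0.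
have [c' e'E] := kdiff_split h VL dV.
by exists V, VU, c'.
Qed.

Lemma qc_csum e : quasi_coherent (csum e).
Proof.
move=> x; have [a xa] := cov x.
exists (basic_open (hL a)), X, X, (fun V (_ : csum 0 V) => 0 : csum 0 V), (@rescale _ (hL a) 0 e).
have [_ _ rres] := rescale_hom (hL a) 0 e.
split=> //.
- by split=> *; rewrite ?addr0 ?scaler0 ?ores0.
- exact: rescale_hom.
- split=> [V VL y|V VL y].
    apply: csumP => A z Vz; rewrite rescaleE //; exact: mulr0.
  move=> y0 z Vz; exists V, (fun _ h => h), 0; split=> //.
  rewrite ores_id -[y](rescaleK (hL := hL a) e y VL) y0.
  by apply: csumP => A w Vw; rewrite rescaleE // cval0 mulr0.
move=> V VL y z Vz; exists V, (fun _ h => h), (rescale (hL a) 0 y).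
by rewrite ores_id (rescaleK _ _ VL).
Qed.

Section Cycles.
Variables (e0 e1 e2 e3 : int) (h01 : e1 = e0 + 1) (h12 : e2 = e1 + 1) (h23 : e3 = e2 + 1).

Definition kcycles : omod k n := ker_sheaf (kdiff_hom h23).
Definition to_kcycles U (c : csum e1 U) : kcycles U := KerSec (kdiffK h12 h23 c).

Lemma to_kcycles_hom : omorphism to_kcycles.
Proof.
have [d1 d2 d3] := kdiff_hom h12.
split=> U *; apply: ker_ext; [exact: d1|exact: d2|exact: d3].
Qed.

Lemma to_kcycles_epi : epi_on (openT k n) to_kcycles.
Proof.
move=> U _ y z /(kdiff_exact h12 (ker_valP y)) [V [VU [c [Vz e]]]].
by exists V, VU, c; split=> //; exact: ker_ext.
Qed.

(** Exactness at [e1] and [e2] presents the cycles as the cokernel of [csum e0 -> csum e1]; where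
    [L a] is invertible, [rescale] replaces both sums by the free sheaf [csum 0]. *)
Lemma qc_kcycles : quasi_coherent kcycles.
Proof.
move=> x; have [a xa] := cov x; set D := basic_open (hL a).
pose r := @rescale _ (hL a).
pose phi V (c : csum 0 V) : csum 0 V := r _ 0 V (kdiff h01 (r 0 e0 V c)).
pose psi V (c : csum 0 V) : kcycles V := to_kcycles (r 0 e1 V c).
have rD e e' := rescale_hom (hL a) e e'.
exists D, X, X, phi, psi; split=> //.
- apply: ohom_comp (rD _ _); apply: ohom_comp (rD _ _) _.
  exact/omorphism_ohom/kdiff_hom.
- apply: ohom_comp (rD _ _) _; exact/omorphism_ohom/to_kcycles_hom.
- split=> [V VD y|V VD y].
    by apply: ker_ext; rewrite /= /r (rescaleK _ _ VD) kdiffK.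
  move=> /(congr1 (@ker_val _ _ _ _ _ _)) /= y0 z Vz.
  have [W [WV [c [Wz e]]]] := kdiff_exact h01 y0 Vz.
  have WD : W `<=o` D by move=> w /WV /VD.
  exists W, WV, (r _ 0 W c); split=> //.
  rewrite /phi /r (rescaleK _ _ WD) e; have [_ _ <- //] := rD 0 e1.
  exact: rescaleK.
- move=> V VD y z Vz.
  have [W [WV [c [Wz e]]]] := to_kcycles_epi (@sub_openT _ _ V) y Vz.
  have WD : W `<=o` D by move=> w /WV /VD.
  by exists W, WV, (r _ 0 W c); split=> //; rewrite /psi /r (rescaleK _ _ WD).
Qed.
End Cycles.

Variable tw : forall (F : omod k n) (q : int), tensor F (twisting k n q).

Definition cinj e U A (f : tws e U) : csum e U :=
  csum_mk (fun B => if B == A then f else 0).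

Lemma cinjE e U A B (f : tws e U) : cval (cinj A f) B = if B == A then f else 0.
Proof. by []. Qed.

Lemma csum_cinj e U (c : csum e U) : c = \sum_A cinj A (cval c A).
Proof.
apply: csumP => B x Ux.
transitivity (\sum_A cval (cinj A (cval c A)) B x); last first.
  by elim/big_rec2: _ => // i y1 y2 _ ->.
rewrite (bigD1 B) //= big1 => [|A /negPf nA].
  by rewrite addr0 cinjE eqxx.
by rewrite cinjE eq_sym nA.
Qed.

Lemma cinj_hom e A : omorphism (fun U (f : twisting k n e U) => cinj A f).
Proof.
split=> U; [move=> _ f g|move=> _ a f|move=> V VU _ f]; apply: csumP => B x Ux.
- by rewrite cvalD !cinjE; case: eqP => // _; rewrite addr0.
- by rewrite cvalZ !cinjE; case: eqP => // _; rewrite mulr0.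
- rewrite cval_res // !cinjE; case: eqP => // _.
  by rewrite /= asboolT.
Qed.

Lemma kdiff_cinj e e' (h : e' = e + 1) U B (f : tws e U) :
  kdiff h (cinj B f) = \sum_A cinj A (hmul (@Th_homog e e' h A B) f).
Proof.
rewrite [LHS]csum_cinj; apply: eq_bigr => A _; congr cinj.
apply: tws_ext => x Ux; rewrite kdiffE (bigD1 B) //= cinjE eqxx big1 ?addr0 //.
by move=> C /negPf nC; rewrite cinjE nC mulr0.
Qed.

(* A Koszul cycle [t] contracts to a map [g] from a twisted Koszul term to [J]
   that kills boundaries; it factors through the sheaf of cycles, extends by
   injectivity, and the extension is the contraction with the sought [u]. *)
Lemma koszul_exact (J : omod k n) (p q r : int)
    (hpq : forall A B, sym_homog (q - p) (Th A B))
    (hqr : forall A B, sym_homog (r - q) (Th A B)) (t : X -> tw J q (openT k n)) :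
  qc_injective J -> q = p + 1 -> r = q + 1 ->
  (forall B, \sum_A gamma_act (tw := tw) (hqr A B) (t A) = 0) ->
  exists u : X -> tw J p (openT k n),
    forall B, \sum_A gamma_act (tw := tw) (hpq A B) (u A) = t B.
Proof.
move=> [_ injJ] eq er cyc.
have rr : r + - r = 0 by rewrite subrr.
have qq : q + - q = 0 by rewrite subrr.
have pp : p + - p = 0 by rewrite subrr.
have h0 : - q = - r + 1 by lia.
have h1 : - p = - q + 1 by lia.
have h2 : - p + 1 = - p + 1 by [].
pose g U (c : csum (- q) U) : J U := \sum_A contract qq (cval c A) (t A).
have hg : omorphism g.
  split=> U.
  - move=> _ c c'; rewrite /g -big_split; apply: eq_bigr => A _ /=.
    exact: (contractDr hL cov).
  - move=> _ a c; rewrite /g scaler_sumr; apply: eq_bigr => A _ /=.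
    exact: (contractZ hL cov).
  - move=> V VU _ c; rewrite /g ores_sum; apply: eq_bigr => A _ /=.
    exact: (contract_res hL cov).
have g_inj U A f : g U (cinj A f) = contract qq f (t A).
  have [c1 _ _] := contract_hom hL cov qq (t A).
  rewrite /g (bigD1 A) //= cinjE eqxx big1 ?addr0 // => B /negPf nB.
  by rewrite cinjE nB (omor0 (contract_hom hL cov qq (t B))).
(* Through [contract_act], the value of [g] on a boundary is a contraction of the row differential
   of [t], which [cyc] makes zero. *)
have gd U (c : csum (- r) U) : g U (kdiff h0 c) = 0.
  rewrite [c]csum_cinj (omor_sum (kdiff_hom h0)) (omor_sum hg) big1 // => B _.
  rewrite kdiff_cinj (omor_sum hg).
  transitivity (contract rr (cval c B) (\sum_A gamma_act (tw := tw) (hqr A B) (t A))).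
    rewrite contract_sum; apply: eq_bigr => A _.
    by rewrite g_inj (contract_act hL cov _ qq rr (@Th_homog _ _ h0 A B)).
  by rewrite cyc; exact: contract0.
have kerg U (c : csum (- q) U) : to_kcycles h1 h2 c = 0 -> g U c = 0.
  move=> /(congr1 (@ker_val _ _ _ _ _ _)) /= c0.
  apply: osep_locally => z /(kdiff_exact h0 c0) [V [VU [c' [Vz e]]]].
  by exists V, VU; split=> //; rewrite -(omor_res hg) -e gd ores0.
have [g' [hg' g'E]] := epi_factor (to_kcycles_hom h1 h2) hg (@to_kcycles_epi _ _ _ h1 h2) kerg.
have [h [hh hE]] := injJ _ _ _ _ (qc_kcycles h0 h1 h2) (qc_csum (- p))
  (ker_incl_hom _) (@ker_incl_mono _ _ _ _ _ (kdiff_hom h2)) hg'.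
have hd U c : h U (kdiff h1 c) = g U c by rewrite -g'E -(hE U).
have uP A : exists u : tw J p (openT k n), forall U (f : tws (- p) U),
    contract pp f u = h U (cinj A f).
  have hA := omorphism_comp (cinj_hom (- p) A) hh.
  by have [u hu] := contract_surj hL cov pp (tw J p) hA; exists u.
pose u A := projT1 (cid (uP A)); have uE A := projT2 (cid (uP A)).
exists u => B; apply/eqP; rewrite -subr_eq0; apply/eqP.
(* Contractions separate sections, so the two sides are compared after contraction with an arbitrary
   [f]. *)
apply: (@contract_inj _ _ _ L hL cov J q (- q) qq (tw J q)) => U f.
rewrite contractD contract_sum.
transitivity (h U (kdiff h1 (cinj B f)) + contract qq f (- t B)).
  congr (_ + _); rewrite kdiff_cinj (omor_sum hh); apply: eq_bigr => A _.
  by rewrite (contract_act hL cov _ pp qq (@Th_homog _ _ h1 A B)) uE.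
by rewrite hd g_inj -contractD addrN contract0.
Qed.
End KoszulSheaf.

(** * Contractions of the exterior algebra in coordinates *)

Section ExteriorHomotopy.
Variables (k : fieldType) (n : nat).
Implicit Types A B C : {set 'I_n}.

Lemma ext_scaleE (c : k) (x : ext k n) A : (c *: x) A = c * x A.
Proof. by rewrite ffunE. Qed.

Lemma ebasis1ME (i : 'I_n) A B : (ebasis k [set i] * ebasis k A) B =
  if (i \notin A) && (B == i |: A) then (-1) ^+ ninv [set i] A else 0 :> k.
Proof.
rewrite ebasisM disjoints1; case: ifP => _ /=; last by rewrite ffunE.
by rewrite !ffunE /GRing.scale /=; case: eqP => _; rewrite ?mulr1 ?mulr0.
Qed.

Lemma ninv1U1 (i j : 'I_n) B : j \notin B ->
  ninv [set i] (j |: B) = ((j < i) + ninv [set i] B)%N.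
Proof.
move=> jB; rewrite ninvUr ?disjoints1 //; congr addn.
by rewrite /ninv !big_set1.
Qed.

(** With [c_i] the contraction by the i-th coordinate form, this is the rule
    [c_i (e_j x) + e_j (c_i x) = delta_ij x] for [x = e_C], read at the coefficient of [e_A]. *)
Lemma sum_ebasis1_antiderivation (i j : 'I_n) A C :
  \sum_B ((ebasis k [set i] * ebasis k A) B * (ebasis k [set j] * ebasis k C) B +
          (ebasis k [set j] * ebasis k B) A * (ebasis k [set i] * ebasis k B) C)
  = ((i == j) && (A == C))%:R :> k.
Proof.
rewrite big_split /=.
have -> : \sum_B (ebasis k [set i] * ebasis k A) B * (ebasis k [set j] * ebasis k C) B =
  if [&& i \notin A, j \notin C & i |: A == j |: C]
  then (-1) ^+ ninv [set i] A * (-1) ^+ ninv [set j] C else 0 :> k.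
  rewrite (bigD1 (i |: A)) //= big1 => [|B /negPf nB]; last first.
    by rewrite ebasis1ME nB andbF mul0r.
  rewrite addr0 !ebasis1ME eqxx andbT.
  by case: (i \notin A); case: (j \notin C); case: eqP; rewrite /= ?mul0r ?mulr0.
have -> : \sum_B (ebasis k [set j] * ebasis k B) A * (ebasis k [set i] * ebasis k B) C =
  if [&& j \in A, i \notin A :\ j & C == i |: (A :\ j)]
  then (-1) ^+ ninv [set j] (A :\ j) * (-1) ^+ ninv [set i] (A :\ j) else 0 :> k.
  rewrite (bigD1 (A :\ j)) //= big1 => [|B nB]; last first.
    rewrite ebasis1ME; case: ifP => [/andP[jB /eqP e]|_]; last by rewrite mul0r.
    by case/eqP: nB; rewrite e finset.setU1K.
  rewrite addr0 !ebasis1ME !inE eqxx /=.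
  have [jA|jA] := boolP (j \in A).
    by rewrite finset.setD1K // eqxx; case: ifP; rewrite ?mulr0.
  case: eqP => [e|_]; last by rewrite mul0r.
  by case/negP: jA; rewrite e finset.setU11.
(* For [i = j] and [A = C] exactly one term survives, depending on whether [i] lies in [A], and it
   is the square of a sign. *)
have [<-{j}|nij] /= := eqVneq i j.
  have [<-{C}|nAC] := eqVneq A C.
    rewrite !inE eqxx /=.
    have [iA|iA] := boolP (i \in A) => /=.
      by rewrite finset.setD1K // !eqxx /= add0r -exprD addnn -signr_odd odd_double expr0.
    by rewrite addr0 -exprD addnn -signr_odd odd_double expr0.
  rewrite !ifF ?addr0 //.
    by apply/negP => /and3P[iA _ /eqP e]; case/eqP: nAC; rewrite e finset.setD1K.
  apply/negP => /and3P[iA iC /eqP e]; case/eqP: nAC.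
  by rewrite -(finset.setU1K iA) e finset.setU1K.
(* For distinct [i] and [j] the two terms are nonzero together, with opposite signs because exactly
   one of [i < j] and [j < i] holds. *)
case: ifP => [/and3P[iA jC /eqP e]|h1].
  have jA : j \in A.
    by have := finset.setU11 j C; rewrite -e !inE eq_sym (negPf nij).
  have eC : C = i |: (A :\ j).
    rewrite -(finset.setU1K jC) -e; apply/finset.setP => x; rewrite !inE.
    by case: eqP => //= ->; rewrite eq_sym (negPf nij).
  have iAj : i \notin A :\ j by rewrite !inE (negPf iA) andbF.
  have jAj : j \notin A :\ j by rewrite !inE eqxx.
  rewrite jA iAj eC eqxx /= -{1}(finset.setD1K jA) !ninv1U1 // !exprD.
  have -> : (-1) ^+ (j < i) = - (-1) ^+ (i < j) :> k.
    by case: ltngtP nij => [||/val_inj ->]; rewrite ?eqxx // ?expr0 ?expr1 ?opprK.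
  have aa : (-1) ^+ (i < j) * (-1) ^+ (i < j) = 1 :> k.
    by case: (i < j)%N; rewrite ?expr0 ?expr1 ?mulrNN mulr1.
  by rewrite mulrACA mulNr aa mulN1r [X in - X]mulrC addNr.
rewrite ifF ?addr0 //; apply/negP => /and3P[jA iAj /eqP e]; move: h1.
have iA : i \notin A by move: iAj; rewrite !inE nij.
rewrite iA e !inE eq_sym (negPf nij) eqxx /= => /negP; apply.
by apply/eqP; rewrite finset.setUCA finset.setD1K.
Qed.
End ExteriorHomotopy.

(** * The Koszul matrix, its homotopies, and the cover by linear forms *)

Section KoszulMatrix.
Variables (k : fieldType) (V : vectType k).
Local Notation W := 'Hom(V, k^o).
Local Notation n := (\dim {:V}).
Local Notation N := (\dim {:W}).

(* Left multiplication by this element is the transpose of the contraction by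
   w, which is why [kcontr] has its two indices exchanged. *)
Definition form_in (w : W) : ext k n :=
  \sum_i w (tnth (vbasis {:V}) i) *: ebasis k [set i].

Lemma scale_sumM (c : 'I_n -> k) (A B : {set 'I_n}) :
  ((\sum_i c i *: ebasis k [set i]) * ebasis k A) B =
  \sum_i c i * (ebasis k [set i] * ebasis k A) B :> k.
Proof.
rewrite mulr_suml sum_ffunE; apply: eq_bigr => i _.
by rewrite -scalerAl ffunE.
Qed.

Lemma contraction_homotopy (w : W) (u : V) (A C : {set 'I_n}) :
  \sum_B ((form_in w * ebasis k A) B * (ext_in u * ebasis k C) B +
          (ext_in u * ebasis k B) A * (form_in w * ebasis k B) C)
  = (A == C)%:R * w u :> k.
Proof.
pose c i : k := w (tnth (vbasis {:V}) i).
pose d i : k := coord (vbasis {:V}) i u.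
pose P (i : 'I_n) (A B : {set 'I_n}) : k := (ebasis k [set i] * ebasis k A) B.
transitivity (\sum_i \sum_j c i * d j * \sum_B (P i A B * P j C B + P j B A * P i B C)).
  under [RHS]eq_bigr => i _ do under eq_bigr => j _ do rewrite mulr_sumr.
  under [RHS]eq_bigr => i _ do rewrite exchange_big.
  rewrite [RHS]exchange_big; apply: eq_bigr => B _ /=.
  rewrite !scale_sumM !big_distrlr /=.
  rewrite [X in _ + X]exchange_big -big_split; apply: eq_bigr => i _ /=.
  rewrite -big_split; apply: eq_bigr => j _ /=.
  by rewrite mulrDr mulrACA; congr (_ + _); rewrite mulrACA [d j * _]mulrC.
under eq_bigr => i _ do under eq_bigr => j _ do
  rewrite /P sum_ebasis1_antiderivation.
transitivity (\sum_i (A == C)%:R * (c i * d i)).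
  apply: eq_bigr => i _; rewrite (bigD1 i) //= eqxx big1 ?addr0 1?mulrC // => j.
  by rewrite eq_sym => /negPf ->; rewrite mulr0.
rewrite -mulr_sumr; congr (_ * _).
rewrite [X in _ = w X](coord_vbasis (memvf u)) linear_sum; apply: eq_bigr => i _.
by rewrite linearZ /= mulrC /c (tnth_nth 0).
Qed.

Section Cover.
Variables (m : nat) (v : m.-tuple W).

Lemma sym_inP (c : k) (w w' : W) : sym_in (c *: w + w') = c *: sym_in w + sym_in w'.
Proof.
rewrite /sym_in scaler_sumr -big_split; apply: eq_bigr => i _ /=.
by rewrite linearP scalerDl scalerA.
Qed.

Lemma sym_in_basis (i : 'I_N) : sym_in (vbasis {:W})`_i = 'X_i :> SymAlg W.
Proof.
rewrite /sym_in (bigD1 i) //= coord_free ?(basis_free (vbasisP _)) // eqxx scale1r.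
rewrite big1 ?addr0 // => j /negPf ji.
by rewrite coord_free ?(basis_free (vbasisP _)) // eq_sym ji scale0r.
Qed.

Variable y : proj_pt k N.

Lemma pidealZ (c : k) a : y a -> y (c *: a).
Proof. by move=> ya; rewrite -mul_mpolyC; exact: pidealM. Qed.

Lemma pideal_sum (I : eqType) (r : seq I) (f : I -> SymAlg W) :
  (forall i, i \in r -> y (f i)) -> y (\sum_(i <- r) f i).
Proof.
elim: r => [|i r IH] h; first by rewrite big_nil; exact: pideal0.
rewrite big_cons; apply: pidealD; first by apply: h; rewrite mem_head.
by apply: IH => j jr; apply: h; rewrite inE jr orbT.
Qed.

(** A prime containing a basis of the linear forms contains all variables, hence all homogeneous
    elements of positive degree, which [pideal_relevant] forbids. *)
Lemma basis_no_common_zero : basis_of fullv v -> exists a, ~ y (sym_in (tnth v a)).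
Proof.
move=> bv; apply: contrapT => /forallNP h.
have yv a : y (sym_in (tnth v a)) by exact: contrapT (h a).
have yw w : y (sym_in w).
  rewrite (coord_basis bv (memvf w)).
  have -> : sym_in (\sum_i coord v i w *: v`_i) = \sum_i coord v i w *: sym_in (tnth v i).
    have s0 : sym_in (0 : W) = 0.
      by rewrite /sym_in big1 // => i _; rewrite linear0 scale0r.
    elim/big_rec2: _ => // i a b _ <-.
    by rewrite sym_inP (tnth_nth 0).
  by apply: pideal_sum => i _; apply: pidealZ.
have [d [a [d0 ad ya]]] := pideal_relevant y.
apply: ya; rewrite [a]mpolyE; apply: pideal_sum => mm am; apply: pidealZ.
have /existsP [i mi] : [exists i, mm i != 0%N].
  apply: contraTT d0; rewrite negb_exists => /forallP m0.
  have /dhomogP/(_ _ am) /= <- := ad; rewrite mdegE big1 // => i _.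
  by apply/eqP; move: (m0 i); rewrite negbK.
have le : (U_(i) <= mm)%MM by rewrite lep1mP.
rewrite -(submK le) mpolyXD -sym_in_basis; exact: pidealM.
Qed.
End Cover.

Section Matrix.
Variables (m : nat) (v : 'I_m -> W) (v' : 'I_m -> V).
Implicit Types A B C : {set 'I_n}.

(** The matrix of left multiplication by the sum of the [v'_a (x) v_a], from [e_B] to [e_A]. *)
Definition kmat A B : SymAlg W :=
  \sum_a ((ext_in (v' a) * ebasis k B) A : k) *: sym_in (v a).

Lemma kmat_homog A B : kmat A B \is 1.-homog.
Proof. by apply: rpred_sum => a _; apply: rpredZ; exact: sym_in_homog. Qed.

(** The images of the [v'_a] anticommute and have square zero, while those of the [v_a] commute. *)
Lemma kmat_sq A C : \sum_B kmat A B * kmat B C = 0.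
Proof.
transitivity (\sum_a \sum_b ((ext_in (v' a) * (ext_in (v' b) * ebasis k C)) A : k) *:
    (sym_in (v a) * sym_in (v b))).
  rewrite /kmat; under eq_bigr => B _ do rewrite big_distrlr /=.
  rewrite exchange_big; apply: eq_bigr => a _ /=.
  rewrite exchange_big; apply: eq_bigr => b _ /=.
  rewrite {2}[ext_in (v' b) * ebasis k C]ext_basisE mulr_sumr sum_ffunE scaler_suml.
  apply: eq_bigr => B _.
  by rewrite -[in RHS]scalerAr ext_scaleE -scalerAl -[in LHS]scalerAr scalerA mulrC.
apply: sum_alt => [a|a b]; first by rewrite mulrA ext_in_sq mul0r ffunE scale0r.
rewrite [sym_in (v b) * _]mulrC -scaleNr !mulrA ext_in_anti mulNr; congr (_ *: _).
by rewrite ffunE.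
Qed.

Definition kcontr a A B : k := (form_in (v a) * ebasis k A) B.

(** Each summand [b] contributes [v_a(v'_b) v_b] by [contraction_homotopy], and duality keeps only
    [b = a]. *)
Lemma kmat_homotopy a A C : (forall i j, v i (v' j) = (i == j)%:R) ->
  \sum_B ((kcontr a A B)%:MP * kmat B C + kmat A B * (kcontr a B C)%:MP) =
  (A == C)%:R * sym_in (v a).
Proof.
move=> dual.
transitivity (\sum_b ((A == C)%:R * v a (v' b) : k) *: sym_in (v b)).
  under [RHS]eq_bigr => b _ do rewrite -contraction_homotopy scaler_suml.
  rewrite [RHS]exchange_big; apply: eq_bigr => B _ /=.
  rewrite [_ * (kcontr a B C)%:MP]mulrC !mul_mpolyC !scaler_sumr -big_split.
  apply: eq_bigr => b _ /=.
  by rewrite !scalerA -scalerDl [kcontr a B C * _]mulrC.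
rewrite (bigD1 a) //= big1 ?addr0 => [|b /negPf ba].
  by rewrite dual eqxx mulr1; case: eqP => _; rewrite ?scale1r ?mul1r ?scale0r ?mul0r.
by rewrite dual [a == b]eq_sym ba mulr0 scale0r.
Qed.
End Matrix.
End KoszulMatrix.

(** * From exact rows to an acyclic total complex *)

Section TotalComplex.
Variables (k : fieldType) (V : vectType k).
Local Notation W := 'Hom(V, k^o).
Local Notation n := (\dim {:V}).
Local Notation hS := (@sym_homog k (\dim {:W})).

Lemma gact0l (M : gmod hS) q r a (ha : hS (r - q) a) (x : M q) : a = 0 -> gact ha x = 0.
Proof.
move=> a0; have haa : hS (r - q) (a + a) by rewrite a0 addr0 -a0.
apply: (addrI (gact ha x)); rewrite addr0 -(gactDl _ _ haa).
by apply: gact_irr; rewrite a0 addr0.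
Qed.

Lemma gact_suml (M : gmod hS) q r (I : Type) (s : seq I) (f : I -> SymAlg W)
    (hf : forall i, hS (r - q) (f i)) (hs : hS (r - q) (\sum_(i <- s) f i)) (x : M q) :
  gact hs x = \sum_(i <- s) gact (hf i) x.
Proof.
elim: s hs => [|i s IH] hs; first by rewrite [RHS]big_nil gact0l ?big_nil.
have hs' : hS (r - q) (\sum_(i <- s) f i).
  elim: s {IH hs} => [|i0 s0 IH]; first by rewrite big_nil; exact: sym_homog0.
  by rewrite big_cons; apply: sym_homogD.
have hs2 : hS (r - q) (f i + \sum_(i <- s) f i) by exact: sym_homogD.
rewrite [RHS]big_cons -(IH hs') -(gactDl _ _ hs2).
by apply: gact_irr; rewrite big_cons.
Qed.

Variables (s : nat) (v : 'I_s -> W) (v' : 'I_s -> V) (N : gcomplex hS).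
Implicit Types A B : {set 'I_n}.

Definition kmat_deg q q' (h : q' = q + 1) A B : hS (q' - q) (kmat v v' A B) :=
  @Th_homog _ _ _ _ (kmat_homog v v') q q' h A B.
Arguments kmat_deg [q q'] h A B.

(* The Koszul differential without the convention that its source is in degree
   q - 1, which saves transports along equalities of degrees. *)
Definition krow p q q' (h : q' = q + 1) (t : {set 'I_n} -> N p q) B : N p q' :=
  \sum_A gact (kmat_deg h A B) (t A).

Lemma kscale_gactE p q r (c : k) a (ha : hS (r - q) a) (hca : hS (r - q) (c *: a)) (x : N p q) :
  kscale c (gact ha x) = gact hca x.
Proof.
have h : hS (r - q) (c%:MP * a) by rewrite mul_mpolyC.
by rewrite /kscale -(gactM _ _ h); apply: gact_irr; rewrite mul_mpolyC.
Qed.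

Lemma koszul_krow p q (t : {ffun {set 'I_n} -> N p (q - 1)}) B :
  koszul v v' t B = krow (int_predK q) t B.
Proof.
rewrite koszulE; apply: eq_bigr => A _.
have hf a : hS (q - (q - 1)) (((ext_in (v' a) * ebasis k B) A : k) *: sym_in (v a)).
  rewrite -mul_mpolyC -[q - (q - 1)]add0r -(subrr 0); apply: sym_homogM.
    exact: sym_homogC.
  exact: var_homog.
rewrite /kmat_deg [RHS](gact_suml hf); apply: eq_bigr => a _.
exact: kscale_gactE.
Qed.

Lemma kmat_neq0 A B : kmat v v' A B != 0 -> #|A|%:Z = 1 + #|B|%:Z.
Proof.
move=> /sum_neq0 [a ha].
have {}ha : (ext_in (v' a) * ebasis k B) A != 0.
  by apply: contraNneq ha => ->; rewrite scale0r.
exact: (ext_homogM (@ext_in_homog _ _ (v' a)) (@ext_homog_ebasis _ _ B) ha).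
Qed.

Hypothesis row_exact : forall p q q' q'' (h : q' = q + 1) (h' : q'' = q' + 1)
  (t : {set 'I_n} -> N p q'), (forall B, krow h' t B = 0) ->
  exists u : {set 'I_n} -> N p q, forall B, krow h u B = t B.

Section Step.
Variables (m0 m1 m2 j : int) (h01 : m1 = m0 + 1) (h12 : m2 = m1 + 1).
Variables (x : tot N m1 j) (pz : int).
Hypotheses (dx0 : totd v v' h12 x = 0) (xlow : forall p q A, p < pz -> x p q A = 0).

(** Quantified over every [q'] equal to [q + 1], so that a lift is used without transport. *)
Let lifts p q (u : {set 'I_n} -> N p q) :=
  forall q' (h : q' = q + 1) B, krow h u B = x p q' B.

Let sgn : int := (-1) ^+ `|pz|%N.
Let sgn2 : sgn * sgn = 1.
Proof. by rewrite -exprD addnn -signr_odd odd_double. Qed.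

Let lift_ex q : exists u, @lifts pz q u.
Proof.
have [|u hu] := @row_exact pz q (q + 1) (q + 1 + 1) erefl erefl (x pz (q + 1)).
  (* At [pz] the [gdiff] part of the differential comes from [pz - 1], where [x] vanishes; only the
     Koszul part of the cycle condition remains. *)
  move=> B; have := congr1 (fun t : tot N m2 j => t pz (q + 1 + 1) B) dx0.
  rewrite totdE xlow ?gtrBl // gdiff0 add0r ffunE -/sgn => /(congr1 (fun y => y *~ sgn)).
  rewrite mul0rz -mulrzA sgn2 mulr1z koszul_krow.
  have e : q + 1 + 1 - 1 = q + 1 by rewrite addrK.
  move: (int_predK (q + 1 + 1)); rewrite e => h <-.
  by apply: eq_bigr => A _; exact: gact_irr.
exists u => q' h B; move: h (h) => -> h; rewrite -hu.
by apply: eq_bigr => A _; exact: gact_irr.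
Qed.

(** The default 0 can occur only off [p = pz], where [yfam] discards the value. *)
Let U p q : {set 'I_n} -> N p q :=
  if pselect (exists u, @lifts p q u) is left e then projT1 (cid e) else fun=> 0.

Let U_lifts q : lifts (U pz q).
Proof. by rewrite /U; case: pselect (lift_ex q) => // e _; exact: projT2 (cid e). Qed.

(** A lift may have components in wrong exterior degrees, which [tot] excludes, so they are cut off.
    The factor [sgn] cancels the sign of the Koszul part at [pz]. *)
Let yfam p q : {ffun {set 'I_n} -> N p q} :=
  [ffun A : {set 'I_n} => if [&& p == pz, p + q == m0 & #|A|%:Z == - (q + j)]
             then U p q A *~ sgn else 0].

Let yfamP p q A : yfam p q A != 0 -> p + q = m0 /\ #|A|%:Z = - (q + j).
Proof. by rewrite ffunE; case: ifP => [/and3P[_ /eqP ? /eqP]|]; rewrite ?eqxx. Qed.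

(** The cut is harmless: a nonzero [kmat A B] forces [#|A| = 1 + #|B|], so the discarded components
    affect only values at which [x] vanishes by [tfamP]. *)
Let krow_y q q' (h : q' = q + 1) B : krow h (yfam pz q) B = x pz q' B *~ sgn.
Proof.
transitivity (if (pz + q == m0) && (#|B|%:Z == - (q' + j))
              then krow h (fun A => U pz q A *~ sgn) B else 0).
  rewrite /krow; case: ifPn => hB; last first.
    rewrite big1 // => A _; have [e|/kmat_neq0 e] := eqVneq (kmat v v' A B) 0.
      exact: gact0l.
    rewrite ffunE ifF ?gact0r //; apply: contraNF hB => /and3P[_ -> /eqP e'].
    by move: e; rewrite e' h /= => e; apply/eqP; lia.
  apply: eq_bigr => A _; have [e|/kmat_neq0 e] := eqVneq (kmat v v' A B) 0.
    by rewrite !gact0l.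
  have /andP[h1 /eqP h2] := hB.
  by rewrite ffunE eqxx h1 ifT //; apply/eqP; rewrite e h2 h; lia.
case: ifPn => hB.
  rewrite -(U_lifts h) /krow sumMz; apply: eq_bigr => A _.
  by apply: addfMz => a b; rewrite gactDr.
have [->|/(tfamP (t := x)) [e1 e2]] := eqVneq (x pz q' B) 0; first by rewrite mul0rz.
by case/negP: hB; rewrite e2 eqxx andbT; apply/eqP; lia.
Qed.

(** [y] lives at [p = pz] only, so its differential meets just [pz] and [pz + 1]: the component of
    [x] at [pz] cancels and those below stay zero. *)
Lemma tot_step : exists y : tot N m0 j, forall p q A, p < pz + 1 ->
  (x - totd v v' h01 y) p q A = 0.
Proof.
exists (Tot yfamP) => p q A hp.
have y0 p' q' : p' != pz -> yfam p' q' = 0.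
  by move=> /negPf np; apply/ffunP => B; rewrite !ffunE np.
rewrite totDE -[(- _ : tot N m1 j) p q]/(- (totd v v' h01 (Tot yfamP) p q)) ffunE totdE /=.
have -> : yfam (p - 1) q A = 0 by rewrite y0 ?ffunE //; apply/eqP; lia.
rewrite gdiff0 add0r koszul_krow.
have [e|np] := eqVneq p pz.
  by rewrite e krow_y -/sgn -mulrzA sgn2 mulr1z subrr.
rewrite xlow; last by move/eqP: np; lia.
rewrite /krow big1 ?mul0rz ?subrr // => B _.
by rewrite y0 // ffunE gact0r.
Qed.
End Step.

Lemma tot_acyclic : acyclic (G_S v v' N).
Proof.
move=> m0 m1 m2 j h01 h12 x dx0.
(* A nonzero component has [p = m1 + j + #|A|], hence [p] lies between [m1 + j] and [m1 + j + n];
   [r] counts the values of [p] still to be cleared, from [n + 1] down to none. *)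
suff main (r : nat) (t : tot N m1 j) : totd v v' h12 t = 0 ->
    (forall p q A, p < m1 + j + n%:Z + 1 - r%:Z -> t p q A = 0) ->
    exists y : tot N m0 j, totd v v' h01 y = t.
  apply: (main n.+1) dx0 _ => p q A hp; apply/eqP; apply: contraTT hp.
  by move=> /(tfamP (t := x)) [e1 e2]; rewrite -leNgt -e1; lia.
elim: r t => [|r IH] t dt0 tlow.
  exists 0; transitivity (0 : tot N m1 j).
    by apply: (addrI (totd v v' h01 0)); rewrite -totd_is_additive !addr0.
  apply: totP => p q A; have -> : (0 : tot N m1 j) p q A = 0 by exact: ffunE.
  apply/esym/eqP; apply: contraTT isT.
  move=> nz; have [e1 e2] := tfamP nz.
  by case/eqP: nz; apply: tlow; have := max_card A; rewrite card_ord; lia.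
have [|y hy] := tot_step h01 dt0 (pz := m1 + j + n%:Z + 1 - r.+1%:Z); first exact: tlow.
have [||y' hy'] := IH (t - totd v v' h01 y).
- by have := totd_is_additive v v' h12 (t - totd v v' h01 y) (totd v v' h01 y);
    rewrite subrK totdK addr0 dt0.
- by move=> p q A hp; apply: hy; lia.
by exists (y + y'); rewrite totd_is_additive hy' addrC subrK.
Qed.
End TotalComplex.

Theorem proposition2p3p1 (k : fieldType) (V : vectType k)
    (m : nat) (v : m.-tuple 'Hom(V, k^o)) (v' : m.-tuple V)
    (hv : dual_bases v v')
    (tw : forall (F : omod k (\dim {:'Hom(V, k^o)})) (q : int),
            tensor F (twisting k (\dim {:'Hom(V, k^o)}) q))
    (Q : ocomplex k (\dim {:'Hom(V, k^o)})) (hQ : in_D_b_coh Q)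
    (I : ocomplex k (\dim {:'Hom(V, k^o)}))
    (f : forall (p : int) (U : opens k (\dim {:'Hom(V, k^o)})), Q p U -> I p U)
    (hf : injective_resolution f) :
  acyclic (G_S (tnth v) (tnth v') (Gamma_star tw I)).
Proof.
have [bv _ dual] := hv; have [_ _ injI _] := hf.
apply: tot_acyclic => p q q' q'' h h' t t0.
pose hom := @kmat_deg _ _ _ (tnth v) (tnth v').
exact: (koszul_exact (kmat_homog (tnth v) (tnth v')) (kmat_sq (tnth v) (tnth v'))
  (fun a => sym_in_homog (tnth v a)) (fun y => basis_no_common_zero y bv)
  (fun a A C => kmat_homotopy a A C dual) (hom _ _ h) (hqr := hom _ _ h')
  (injI p) h h' t0).
Qed.
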